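(* Let $\beta_1\neq\beta_2$ and suppose that the perturbed (Heun type) equation is in a double resonance. Then the monodromy matrices $M_j(\varepsilon)$, $j=R,L$, of the equation with respect to the fundamental matrix $\Phi_0(x,\varepsilon)$ are $$M_j(\varepsilon)=e^{\pi i(\Lambda+\frac1{x_j}B)}\,e^{2\pi iT_j}=e^{2\pi iT_j}\,e^{\pi i(\Lambda+\frac1{x_j}B)},$$ and the monodromy matrices $M_{jj}(\varepsilon)$, $j=R,L$, with respect to the fundamental matrix $\Phi_\infty(x,\varepsilon)$ are $$M_{jj}(\varepsilon)=e^{-\pi i\,x_{jj}G}\,e^{2\pi iT_{jj}}=e^{2\pi iT_{jj}}\,e^{-\pi i\,x_{jj}G}.$$
   Context: Perturbed equation: $L_{2,\varepsilon}(L_{1,\varepsilon}y)=0$, $0<\varepsilon<1$, $\sqrt\varepsilon>0$, $\beta_j,\gamma_j\in\mathbb{C}$, whose first-order factors annihilate respectively $\Phi_1(x,\varepsilon)=\left(\frac{x-\sqrt\varepsilon}{x+\sqrt\varepsilon}\right)^{\frac{\beta_1}{2\sqrt\varepsilon}}\left(\frac{1/\sqrt\varepsilon+x}{1/\sqrt\varepsilon-x}\right)^{\frac{\gamma_1}{2\sqrt\varepsilon}}$, $\Phi_2(x,\varepsilon)=\frac{(x-\sqrt\varepsilon)^{\frac{\beta_2}{2\sqrt\varepsilon}-1}}{(x+\sqrt\varepsilon)^{\frac{\beta_2}{2\sqrt\varepsilon}+1}}\left(\frac{1/\sqrt\varepsilon+x}{1/\sqrt\varepsilon-x}\right)^{\frac{\gamma_2}{2\sqrt\varepsilon}}$.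 Singular points: $x_R=\sqrt\varepsilon$, $x_L=-\sqrt\varepsilon$, $x_{RR}=1/\sqrt\varepsilon$, $x_{LL}=-1/\sqrt\varepsilon$. Put $\Lambda=\mathrm{diag}(0,-2)$, $B=\mathrm{diag}(\beta_1,\beta_2)$, $G=\mathrm{diag}(\gamma_1,\gamma_2)$. Double resonance: one of the following holds, with $\mathbb{N}_0=\{0,1,2,\dots\}$: (A.1) $\frac{\beta_2-\beta_1}{2\sqrt\varepsilon},\frac{\gamma_1-\gamma_2}{2\sqrt\varepsilon}\in\mathbb{N}_0$; (A.2) $\frac{\beta_2-\beta_1}{2\sqrt\varepsilon},\frac{\gamma_2-\gamma_1}{2\sqrt\varepsilon}\in\mathbb{N}_0$; (A.3) $\frac{\beta_1-\beta_2}{2\sqrt\varepsilon},\frac{\gamma_1-\gamma_2}{2\sqrt\varepsilon}\in\mathbb{N}_0$; (A.4) $\frac{\beta_1-\beta_2}{2\sqrt\varepsilon},\frac{\gamma_2-\gamma_1}{2\sqrt\varepsilon}\in\mathbb{N}_0$. Both fundamental matrices have the form $\begin{pmatrix}\Phi_1&\Phi_{12}\\0&\Phi_2\end{pmatrix}$ with $\Phi_{12}(x,\varepsilon)=\Phi_1(x,\varepsilon)\int_{x_*}^x\frac{\Phi_2(z,\varepsilon)}{\Phi_1(z,\varepsilon)}dz$; for $\Phi_0(x,\varepsilon)$ the base point is $x_*=\sqrt\varepsilon$ in cases (A.1),(A.2) and $x_*=-\sqrt\varepsilon$ in cases (A.3),(A.4); for $\Phi_\infty(x,\varepsilon)$ it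 is $x_*=1/\sqrt\varepsilon$ in cases (A.1),(A.3) and $x_*=-1/\sqrt\varepsilon$ in cases (A.2),(A.4). These are multivalued analytic on $\mathbb{CP}^1\setminus\{x_R,x_L,x_{RR},x_{LL}\}$. $T_j=\begin{pmatrix}0&d_j\\0&0\end{pmatrix}$, $T_{jj}=\begin{pmatrix}0&d_{jj}\\0&0\end{pmatrix}$ with $d_j=\mathrm{Res}(\Phi_2/\Phi_1;x=x_j)$, $d_{jj}=\mathrm{Res}(\Phi_2/\Phi_1;x=x_{jj})$. Monodromy matrix at a singular point $a$ with respect to a fundamental matrix $\Phi$: analytic continuation of $\Phi$ along a simple closed loop from a base point $x_0$ encircling $a$ once in the positive direction and no other singular point yields $\Phi\cdot M_a$ with $M_a\in GL_2(\mathbb{C})$; $M_j(\varepsilon),M_{jj}(\varepsilon)$ correspond to $a=x_j,x_{jj}$. *)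

(* Defs.v *)
From HB Require Import structures.
From mathcomp Require Export all_boot all_order all_algebra.
From mathcomp Require Export all_classical all_reals all_analysis.
From mathcomp Require Export complex.

Set Implicit Arguments.
Unset Strict Implicit.
Unset Printing Implicit Defensive.

Import Order.TTheory GRing.Theory Num.Theory.
Export numFieldNormedType.Exports.

Local Open Scope classical_set_scope.
Local Open Scope ring_scope.
Local Open Scope complex_scope.

(* The name triggers the topology and the normed-module structure that
   MathComp-Analysis puts on every numClosedFieldType; over it, derivability in
   the direction 1 is complex differentiability. *)
Definition Cx (R : realType) : numClosedFieldType := R[i].

Section ComplexAnalysis.
Variable R : realType.
Local Notation C := (Cx R).
Implicit Types (f : C -> C) (p : R -> C) (a x z : C) (t : R).

Definition ii : C := 0 +i* 1.

Definition picx : C := (pi : R)%:C.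

Definition cexp z : C :=
  (expR (complex.Re z) * cos (complex.Im z))
    +i* (expR (complex.Re z) * sin (complex.Im z)).

Definition mexp n (A : 'M[C]_n.+1) : 'M[C]_n.+1 :=
  lim (series (fun k : nat => (k`!%:R^-1 : C) *: A ^+ k) @ \oo).

Definition cintegral01 (h : R -> C) : C :=
  (\int[lebesgue_measure]_(t in `[0, 1]) complex.Re (h t))
    +i* (\int[lebesgue_measure]_(t in `[0, 1]) complex.Im (h t)).

Definition velocity p t : C :=
  derive1 (fun u => complex.Re (p u)) t +i* derive1 (fun u => complex.Im (p u)) t.

(* The value of [f] at a single point, e.g. at the initial point of [p], is
   irrelevant. *)
Definition path_integral f p : C :=
  cintegral01 (fun t => f (p t) * velocity p t).

(* Piecewise C^1 paths are covered too: a reparametrization that stops at the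
   corners makes them C^1 and does not change the integrals. *)
Definition C1_path p : Prop :=
  [/\ forall t, t \in `[0, 1] -> derivable (fun u => complex.Re (p u)) t 1,
      forall t, t \in `[0, 1] -> derivable (fun u => complex.Im (p u)) t 1
    & {within `[0, 1], continuous (velocity p)}].

Definition segment x z : R -> C := fun t => x + t%:C * (z - x).

Definition circle a (r : R) : R -> C :=
  fun t => a + r%:C * cexp (2 * picx * ii * t%:C).

(* For an isolated singularity the quantity under the limit does not depend on
   r once r is small. *)
Definition Res f a : C :=
  lim ((2 * picx * ii)^-1 * path_integral f (circle a r) @[r --> 0^'+]).

(* Along merely continuous closed paths the winding number is the total
   variation of a continuous logarithm, divided by 2 pi i. *)
Definition winding p a (n : int) : Prop :=
  exists theta : R -> C,
    [/\ {within `[0, 1], continuous theta},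
        forall t, t \in `[0, 1] -> cexp (theta t) = p t - a
      & theta 1 - theta 0 = 2 * picx * ii * n%:~R].

(* [F t] is (a representative of) the germ at [p t]. *)
Definition continuation_along p (F : R -> C -> 'M[C]_2) : Prop :=
  forall t, t \in `[0, 1] ->
    (\forall x \near p t, derivable (F t) x 1) /\
    (\forall u \near t, u \in `[0, 1] -> \forall x \near p u, F u x = F t x).

Definition continues_to p (Phi Psi : C -> 'M[C]_2) : Prop :=
  exists F : R -> C -> 'M[C]_2,
    [/\ continuation_along p F,
        \forall x \near p 0, F 0 x = Phi x
      & \forall x \near p 1, F 1 x = Psi x].

Definition mx2 (a b c d : C) : 'M[C]_2 :=
  \matrix_(i, j) if i == 0 then (if j == 0 then a else b)
                 else (if j == 0 then c else d).

End ComplexAnalysis.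

Arguments ii {R}.
Arguments picx {R}.

Inductive side := sideR | sideL.

Inductive resonance_case := A1 | A2 | A3 | A4.

Section Heun.
Variable R : realType.
Local Notation C := (Cx R).

Variable eps : R.

Definition se : C := (Num.sqrt eps)%:C.

(* x_R, x_L *)
Definition xj (j : side) : C :=
  match j with sideR => se | sideL => - se end.

(* x_RR, x_LL *)
Definition xjj (j : side) : C :=
  match j with sideR => se^-1 | sideL => - se^-1 end.

Definition sing : seq C := [:: xj sideR; xj sideL; xjj sideR; xjj sideL].

(* (beta_1, beta_2) and (gamma_1, gamma_2) *)
Variables beta gamma : 'rV[C]_2.
Local Notation beta1 := (beta 0 0).
Local Notation beta2 := (beta 0 1).
Local Notation gamma1 := (gamma 0 0).
Local Notation gamma2 := (gamma 0 1).

Definition Lambda : 'M[C]_2 := mx2 0 0 0 (- 2).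
Definition Bmx : 'M[C]_2 := diag_mx beta.
Definition Gmx : 'M[C]_2 := diag_mx gamma.

Definition in_N0 (z : C) : Prop := exists n : nat, z = n%:R.

Definition double_resonance (c : resonance_case) : Prop :=
  match c with
  | A1 => in_N0 ((beta2 - beta1) / (2 * se)) /\ in_N0 ((gamma1 - gamma2) / (2 * se))
  | A2 => in_N0 ((beta2 - beta1) / (2 * se)) /\ in_N0 ((gamma2 - gamma1) / (2 * se))
  | A3 => in_N0 ((beta1 - beta2) / (2 * se)) /\ in_N0 ((gamma1 - gamma2) / (2 * se))
  | A4 => in_N0 ((beta1 - beta2) / (2 * se)) /\ in_N0 ((gamma2 - gamma1) / (2 * se))
  end.

Definition base0 (c : resonance_case) : C :=
  match c with A1 | A2 => xj sideR | A3 | A4 => xj sideL end.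

Definition baseoo (c : resonance_case) : C :=
  match c with A1 | A3 => xjj sideR | A2 | A4 => xjj sideL end.

(* A determination of the multivalued functions: a logarithm of each of the
   factors x - s, x + s, 1/s - x, 1/s + x (s = sqrt eps) at every nonsingular
   point.  It may jump (along cuts); near the base point of the loops it will be
   required to be continuous.  Phi_1, Phi_2 are built from the same logarithms,
   so that their quotient is computed by subtracting exponents; at resonance it
   is a rational function that does not depend on the determination. *)
Record log_branches := LogBranches {
  logR : C -> C;
  logL : C -> C;
  logRR : C -> C;
  logLL : C -> C;
  logRP : forall x, x \notin sing -> cexp (logR x) = x - se;
  logLP : forall x, x \notin sing -> cexp (logL x) = x + se;
  logRRP : forall x, x \notin sing -> cexp (logRR x) = se^-1 - x;
  logLLP : forall x, x \notin sing -> cexp (logLL x) = se^-1 + x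
}.

Variable l : log_branches.

Definition branches_continuous_near (x0 : C) : Prop :=
  \forall x \near x0,
    [/\ {for x, continuous (logR l)}, {for x, continuous (logL l)},
        {for x, continuous (logRR l)} & {for x, continuous (logLL l)}].

Definition Phi1 (x : C) : C :=
  cexp (beta1 / (2 * se) * (logR l x - logL l x)) *
  cexp (gamma1 / (2 * se) * (logLL l x - logRR l x)).

Definition Phi2 (x : C) : C :=
  cexp ((beta2 / (2 * se) - 1) * logR l x) /
  cexp ((beta2 / (2 * se) + 1) * logL l x) *
  cexp (gamma2 / (2 * se) * (logLL l x - logRR l x)).

Definition ratio (x : C) : C := Phi2 x / Phi1 x.

(* The base point xs of the integral is a singular point; the path may leave it
   in any direction but does not meet the singular points afterwards. *)
Definition base_path (xs x0 : C) (p : R -> C) : Prop :=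
  [/\ C1_path p, p 0 = xs, p 1 = x0
    & forall t : R, t \in `]0, 1] -> p t \notin sing].

(* For x near the end point of p, the integral of the ratio from the initial
   point of p to x, along p followed by a segment. *)
Definition base_integral (p : R -> C) (x : C) : C :=
  path_integral ratio p + path_integral ratio (segment (p 1) x).

Definition PhiMx (p : R -> C) (x : C) : 'M[C]_2 :=
  mx2 (Phi1 x) (Phi1 x * base_integral p x)
      0        (Phi2 x).

Definition Tj (j : side) : 'M[C]_2 := mx2 0 (Res ratio (xj j)) 0 0.
Definition Tjj (j : side) : 'M[C]_2 := mx2 0 (Res ratio (xjj j)) 0 0.

(* The coefficients are the logarithmic derivatives of Phi_1 and Phi_2. *)
Definition L1 (y : C -> C) (x : C) : C :=
  'D_1 y x
  - (beta1 / (x ^+ 2 - eps%:C) + gamma1 / (1 - eps%:C * x ^+ 2)) * y x.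
Definition L2 (y : C -> C) (x : C) : C :=
  'D_1 y x
  - ((beta2 - 2 * x) / (x ^+ 2 - eps%:C) + gamma2 / (1 - eps%:C * x ^+ 2)) * y x.

(* First row: two solutions y of L2 (L1 y) = 0; second row: L1 y. *)
Definition fundamental_matrix_near (x0 : C) (Phi : C -> 'M[C]_2) : Prop :=
  \forall x \near x0,
    [/\ derivable Phi x 1,
        forall k, L2 (L1 (fun z => Phi z 0 k)) x = 0,
        forall k, Phi x 1 k = L1 (fun z => Phi z 0 k) x
      & Phi x \in unitmx].

(* "Once, in the positive direction, and no other singular point" is expressed
   by winding numbers. *)
Definition simple_loop_around (a x0 : C) (p : R -> C) : Prop :=
  [/\ {within `[0, 1], continuous p},
      p 0 = x0 /\ p 1 = x0,
      {in `[0, 1[ &, injective p},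
      forall t, t \in `[0, 1] -> p t \notin sing
    & winding p a 1 /\ forall b, b \in sing -> b != a -> winding p b 0].

Definition monodromy_matrix (a x0 : C) (Phi : C -> 'M[C]_2) (M : 'M[C]_2) : Prop :=
  [/\ fundamental_matrix_near x0 Phi,
      M \in unitmx
    & forall p, simple_loop_around a x0 p ->
        continues_to p Phi (fun x => Phi x *m M)].

End Heun.

(* Main.v *)
(* Along a path avoiding the poles, the four logarithms log(x - b) are continued
   by adding the increment of a continuous logarithm of p - b to a principal
   logarithm of (x - b)/(p - b).  A loop that winds once around the pole a and
   not around the others therefore adds 2 pi i to log(x - a) only.  Phi_1 and
   Phi_2 are exponentials of linear combinations of these logarithms.  At
   resonance Phi_2/Phi_1 is rational with poles at two points at most (beta_1 <>
   beta_2 excludes a third), so by partial fractions its primitive is Q + sum_b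
   d_b log(x - b) with Q rational and d_b the residues: around a the integral
   grows by 2 pi i d_a, while both Phi_1 and Phi_2 are multiplied by the same
   number, their exponents at a differing by an integer.  The path of integration
   contributes only an additive constant, so its initial point plays no role. *)
From mathcomp Require Import ring lra.
Require Import Defs.

Set Implicit Arguments.
Unset Strict Implicit.
Unset Printing Implicit Defensive.

Import Order.TTheory GRing.Theory Num.Theory.
Local Open Scope classical_set_scope.
Local Open Scope ring_scope.
Local Open Scope complex_scope.

(** * Complex numbers *)

(** The given branches may jump away from [x0], while residues are integrals around the poles, far
    from [x0]. The way out: for an integer [k], [cexp (k * v)] depends on [cexp v] only. The
    exponents of the ratio are integers, so it can be computed with any logarithms, in particular
    with local analytic ones. The coefficients [c] of the simple poles serve twice: a circle
    integral identifies [c a] with the residue, and the same [c a] multiplies the increment of log(x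
    - a) along the loop. Uniqueness of partial fractions is never invoked. Gluing local logarithms
    rests on one inequality: if two centre values differ by less than pi in imaginary part, the
    logarithms differ by less than pi + pi/2 + pi/2 = 2 pi on the common disc, hence agree there. At
    each singular point the two diagonal entries of the exponential coincide, again because the
    exponents differ by an integer. This factor is a scalar matrix, which is why it commutes with
    the unipotent one. *)

Section ComplexPlane.
Variable R : realType.
Local Notation C := (Cx R).
Local Notation Re := (@complex.Re R).
Local Notation Im := (@complex.Im R).
Implicit Types (z w : C).

Lemma complex_eqP z w : z = w <-> Re z = Re w /\ Im z = Im w.
Proof. by case: z w => [a b] [c d]; split => [[-> ->]|[/= -> ->]]. Qed.

Lemma ReD z w : Re (z + w) = Re z + Re w. Proof. by case: z w => [? ?] []. Qed.
Lemma ImD z w : Im (z + w) = Im z + Im w. Proof. by case: z w => [? ?] []. Qed.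
Lemma ReN z : Re (- z) = - Re z. Proof. by case: z. Qed.
Lemma ImN z : Im (- z) = - Im z. Proof. by case: z. Qed.
Lemma ReB z w : Re (z - w) = Re z - Re w. Proof. by rewrite ReD ReN. Qed.
Lemma ImB z w : Im (z - w) = Im z - Im w. Proof. by rewrite ImD ImN. Qed.
Lemma ReM z w : Re (z * w) = Re z * Re w - Im z * Im w.
Proof. by case: z w => [? ?] []. Qed.
Lemma ImM z w : Im (z * w) = Re z * Im w + Im z * Re w.
Proof. by case: z w => [? ?] []. Qed.
Lemma Re0 : Re (0 : C) = 0. Proof. by []. Qed.
Lemma Im0 : Im (0 : C) = 0. Proof. by []. Qed.
Lemma Re1 : Re (1 : C) = 1. Proof. by []. Qed.
Lemma Im1 : Im (1 : C) = 0. Proof. by []. Qed.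

Definition ReImE := (ReB, ImB, ReD, ImD, ReN, ImN, ReM, ImM, Re0, Im0, Re1, Im1).

Lemma complex_split z : z = (Re z)%:C + ii * (Im z)%:C.
Proof. by apply/complex_eqP; rewrite !ReImE /=; split; ring. Qed.

(** In the order of a [numClosedFieldType] only reals are comparable with 0. This turns every
    complex epsilon into a real one. *)
Lemma ltC_real (e : C) : 0 < e -> exists2 r : R, 0 < r & e = r%:C.
Proof. by case: e => a b /andP[/eqP/= -> a0]; exists a. Qed.

Lemma normC_real z : `|z| = (Re `|z|)%:C.
Proof. by case: z. Qed.

Lemma real_complex_norm (r : R) : `|r%:C : C| = `|r|%:C.
Proof. by apply/complex_eqP; rewrite /= expr0n addr0 sqrtr_sqr. Qed.

Lemma normC_Re z : (`|Re z|)%:C <= `|z|.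
Proof.
case: z => a b; rewrite [leRHS]/Num.Def.normr/= lecR -sqrtr_sqr ler_sqrt ?addr_ge0 ?sqr_ge0//.
by rewrite lerDl sqr_ge0.
Qed.

Lemma normC_Im z : (`|Im z|)%:C <= `|z|.
Proof.
case: z => a b; rewrite [leRHS]/Num.Def.normr/= lecR -sqrtr_sqr ler_sqrt ?addr_ge0 ?sqr_ge0//.
by rewrite lerDr sqr_ge0.
Qed.

Lemma normC_le z : `|z| <= (`|Re z| + `|Im z|)%:C.
Proof.
rewrite {1}(complex_split z) (le_trans (ler_normD _ _))// normrM !real_complex_norm.
have -> : `|ii : C| = 1 by rewrite [LHS]/Num.Def.normr/= expr0n expr1n add0r sqrtr1.
by rewrite mul1r rmorphD.
Qed.

Section filter.
Context {T : Type} (F : set_system T) {FF : Filter F}.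

Lemma cvg_Re (f : T -> C) (l : C) :
  f t @[t --> F] --> l -> Re (f t) @[t --> F] --> Re l.
Proof.
move=> /cvgrPdist_lt fl; apply/cvgrPdist_lt => e e0.
have e0' : 0 < (e%:C : C) by rewrite ltcR.
apply: filterS (fl _ e0') => x; rewrite -ltcR -ReB.
exact: le_lt_trans (normC_Re _).
Qed.

Lemma cvg_Im (f : T -> C) (l : C) :
  f t @[t --> F] --> l -> Im (f t) @[t --> F] --> Im l.
Proof.
move=> /cvgrPdist_lt fl; apply/cvgrPdist_lt => e e0.
have e0' : 0 < (e%:C : C) by rewrite ltcR.
apply: filterS (fl _ e0') => x; rewrite -ltcR -ImB.
exact: le_lt_trans (normC_Im _).
Qed.

Lemma cvg_realC (f : T -> R) (l : R) :
  f t @[t --> F] --> l -> ((f t)%:C : C) @[t --> F] --> (l%:C : C).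
Proof.
move=> /cvgrPdist_lt fl; apply/cvgrPdist_lt => e /ltC_real[r r0 ->].
by apply: filterS (fl _ r0) => x; rewrite -rmorphB real_complex_norm ltcR.
Qed.

Lemma cvgCP (f : T -> C) (l : C) :
  f t @[t --> F] --> l <->
  Re (f t) @[t --> F] --> Re l /\ Im (f t) @[t --> F] --> Im l.
Proof.
split=> [fl|[rl il]]; first by split; [exact: cvg_Re|exact: cvg_Im].
rewrite (complex_split l) (_ : f = fun t => (Re (f t))%:C + ii * (Im (f t))%:C); last first.
  by apply/funext => t; exact: complex_split.
apply: cvgD; first exact: cvg_realC.
by apply: cvgM; [exact: cvg_cst|exact: cvg_realC].
Qed.

End filter.

Lemma nearCP z (P : set C) :
  (\forall x \near z, P x) <->
  exists2 r : R, 0 < r & forall x : C, `|x - z| < r%:C -> P x.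
Proof.
split=> [/nbhs_ballP[e /= /ltC_real[r r0 ->] H]|[r r0 H]].
  by exists r => // x xz; apply: H; rewrite /ball/= distrC.
apply/nbhs_ballP; exists (r%:C) => /=; first by rewrite ltcR.
by move=> x; rewrite /ball/= distrC; exact: H.
Qed.

Lemma Re_cexp z : Re (cexp z) = expR (Re z) * cos (Im z). Proof. by []. Qed.
Lemma Im_cexp z : Im (cexp z) = expR (Re z) * sin (Im z). Proof. by []. Qed.

Lemma cexpD z w : cexp (z + w) = cexp z * cexp w.
Proof.
by apply/complex_eqP; rewrite !(Re_cexp, Im_cexp, ReImE) expRD cosD sinD; split; ring.
Qed.

Lemma cexp0 : cexp 0 = 1 :> C.
Proof. by apply/complex_eqP; rewrite /= expR0 cos0 sin0 mulr1 mulr0. Qed.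

Lemma cexpNM z : cexp (- z) * cexp z = 1.
Proof. by rewrite -cexpD addNr cexp0. Qed.

Lemma cexp_neq0 z : cexp z != 0.
Proof.
apply/eqP => z0; have := cexpNM z; rewrite z0 mulr0 => /eqP.
by rewrite eq_sym oner_eq0.
Qed.

Lemma cexpN z : cexp (- z) = (cexp z)^-1.
Proof. by apply: (mulIf (cexp_neq0 z)); rewrite cexpNM mulVf ?cexp_neq0. Qed.

Lemma cexpB z w : cexp (z - w) = cexp z / cexp w.
Proof. by rewrite cexpD cexpN. Qed.

Lemma cexp_natM n z : cexp (n%:R * z) = cexp z ^+ n.
Proof.
elim: n => [|n IH]; first by rewrite mul0r cexp0.
by rewrite -natr1 mulrDl mul1r cexpD IH exprSr.
Qed.

Lemma two_pi_iiE (t : R) : 2 * picx * ii * t%:C = 0 +i* (pi *+ 2 * t) :> C.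
Proof. by apply/complex_eqP; split => /=; ring. Qed.

Lemma cexp_2pii : cexp (2 * picx * ii) = 1 :> C.
Proof.
rewrite -[2 * picx * ii]mulr1 (two_pi_iiE 1) mulr1.
by apply/complex_eqP; rewrite /= expR0 !mul1r cos2pi sin2pi.
Qed.

(** The sine vanishes and the cosine is positive, so the cosine is 1 and [Re z = 0]. With y = |Im
    z|, cos y = 1 - 2 sin(y/2)^2 forces sin(y/2) = 0, impossible for 0 < y/2 < pi. This is the
    source of all uniqueness of logarithms below. *)
Lemma cexp_eq1 z : cexp z = 1 -> `|Im z| < pi *+ 2 -> z = 0.
Proof.
move=> /complex_eqP/= [ec es] iz.
have e0 := expR_gt0 (Re z).
have s0 : sin (Im z) = 0 by move/eqP: es; rewrite mulf_eq0 gt_eqF//= => /eqP.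
have c2 : cos (Im z) ^+ 2 = 1 by rewrite -(cos2Dsin2 (Im z)) s0 expr0n addr0.
have cgt0 : 0 < cos (Im z) by rewrite -(pmulr_rgt0 _ e0) ec.
have c1 : cos (Im z) = 1.
  by apply/eqP; rewrite -(@eqrXn2 _ 2) ?expr1n ?c2// ltW.
have r0 : Re z = 0 by apply: expR_inj; rewrite expR0 -ec c1 mulr1.
have i0 : Im z = 0.
  set y := `|Im z|.
  have cy : cos y = 1 by rewrite cos_norm.
  apply/eqP; rewrite -normr_eq0 -/y; apply/negPn/negP => y0.
  have y2 : 0 < y / 2 < pi.
    apply/andP; split; first by rewrite divr_gt0// lt_def y0 normr_ge0.
    by rewrite ltr_pdivrMr// mulr_natr.
  have := sin_gt0_pi y2.
  have : cos (y / 2 *+ 2) = 1 by rewrite -mulr_natr divfK.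
  rewrite cos_mulr2n cos2sin2 => h; have : sin (y / 2) ^+ 2 = 0 by lra.
  by move/eqP; rewrite sqrf_eq0 => /eqP ->; rewrite ltxx.
by apply/complex_eqP.
Qed.

End ComplexPlane.

(** * Complex and real derivatives *)

Section Derivatives.
Variable R : realType.
Local Notation C := (Cx R).
Local Notation Re := (@complex.Re R).
Local Notation Im := (@complex.Im R).
Implicit Types (z w v : C) (t r : R).

Lemma cvgCdistP {T : Type} (F : set_system T) {FF : Filter F} (f : T -> C) (l : C) :
  f t @[t --> F] --> l <->
  forall r, 0 < r -> \forall t \near F, `|f t - l| < r%:C.
Proof.
split=> [/cvgrPdist_lt fl r r0|fl].
  have r0' : 0 < (r%:C : C) by rewrite ltcR.
  by apply: filterS (fl _ r0') => x; rewrite distrC.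
apply/cvgrPdist_lt => e /ltC_real[r r0 ->].
by apply: filterS (fl _ r0) => x; rewrite distrC.
Qed.

Section limits_at_a_point.
Variable z : C.
Implicit Types (f g : C -> C) (a b : C).

Lemma cvgC_id : w @[w --> z] --> z. Proof. exact: (@cvg_id _ (nbhs z)). Qed.

Lemma cvgC_cst a : a @[w --> z] --> a.
Proof. exact: (@cvg_cst _ a C (nbhs z) _). Qed.

Lemma cvgC_D f g a b : f w @[w --> z] --> a -> g w @[w --> z] --> b ->
  f w + g w @[w --> z] --> a + b.
Proof. by move=> fa gb; exact: (@cvgD _ _ _ (nbhs z) _ f g a b fa gb). Qed.

Lemma cvgC_B f g a b : f w @[w --> z] --> a -> g w @[w --> z] --> b ->
  f w - g w @[w --> z] --> a - b.
Proof. by move=> fa gb; exact: (@cvgB _ _ _ (nbhs z) _ f g a b fa gb). Qed.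

Lemma cvgC_M f g a b : f w @[w --> z] --> a -> g w @[w --> z] --> b ->
  f w * g w @[w --> z] --> a * b.
Proof. by move=> fa gb; exact: (@cvgM _ _ (nbhs z) _ f g a b fa gb). Qed.

Lemma cvgC_V f a : a != 0 -> f w @[w --> z] --> a -> (f w)^-1 @[w --> z] --> a^-1.
Proof. by move=> a0 fa; exact: (@cvgV _ _ (nbhs z) _ f a a0 fa). Qed.

End limits_at_a_point.

(** Without a quotient, the chain rule needs no case distinction where the inner map repeats its
    value, and the inner map may equally be a curve with a real parameter. *)
Lemma is_derive_Caratheodory (G : C -> C) z g :
  is_derive z 1 G g ->
  exists phi : C -> C, [/\ phi w @[w --> z] --> phi z, phi z = g
    & forall w, G w - G z = phi w * (w - z)].
Proof.
move=> [dG Gg].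
exists (fun w => if w == z then g else (G w - G z) / (w - z)).
split; [|by rewrite eqxx|]; last first.
  move=> w; case: eqP => [->|/eqP wz]; first by rewrite !subrr mulr0.
  by rewrite divfK// subr_eq0.
rewrite eqxx; apply/(@cvgCdistP _ (nbhs z)) => r r0.
have : (fun h : C => h^-1 *: (G (h *: 1 + z) - G z)) h @[h --> 0^'] --> g.
  by rewrite -Gg; exact: dG.
move=> /(@cvgCdistP _ (0^') _)/(_ r r0).
move=> /(@nearCP R 0 (fun h => h != 0 -> _))[d d0 H].
apply/nearCP; exists d => // w wz /=; have [_|wz0] := eqVneq w z.
  by rewrite subrr normr0 ltcR.
have := H (w - z); rewrite subr0 wz subr_eq0 => /(_ isT wz0).
by rewrite /GRing.scale /= mulr1 subrK mulrC.
Qed.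

Lemma Caratheodory_is_derive (G phi : C -> C) z :
  phi w @[w --> z] --> phi z ->
  (\forall w \near z, G w - G z = phi w * (w - z)) -> is_derive z 1 G (phi z).
Proof.
move=> /(@cvgCdistP _ (nbhs z) _) cphi /nearCP[d1 d10 H1].
have : h^-1 *: (G (h *: 1 + z) - G z) @[h --> (0 : C)^'] --> phi z.
  apply/(@cvgCdistP _ ((0 : C)^') _) => r r0.
  have /nearCP[d d0 H] := cphi r r0.
  apply/(@nearCP R 0 (fun h => h != 0 -> _)).
  exists (Num.min d d1); first by rewrite lt_min d0.
  move=> h; rewrite subr0 => hd h0.
  have [hd0 hd1] : `|h| < d%:C /\ `|h| < d1%:C.
    by move: hd; rewrite normC_real !ltcR lt_min => /andP.
  rewrite /GRing.scale /= mulr1 H1 addrK // mulrCA mulVf // mulr1.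
  by apply: H; rewrite addrK.
move=> c; apply: DeriveDef; last exact/cvg_lim.
by apply/cvg_ex; exists (phi z).
Qed.

Lemma is_derive_cvg (G : C -> C) z g : is_derive z 1 G g -> G w @[w --> z] --> G z.
Proof.
move=> /is_derive_Caratheodory[phi [cphi _ H]].
have -> : G = fun w => G z + phi w * (w - z).
  by apply/funext => w; rewrite -H addrCA subrr addr0.
suff : (G z + phi w * (w - z)) @[w --> z] --> G z + phi z * (z - z).
  by rewrite subrr mulr0 addr0.
apply: cvgC_D; first exact: cvgC_cst.
exact: cvgC_M cphi (cvgC_B (@cvgC_id z) (@cvgC_cst z z)).
Qed.

Lemma is_derive_compC (G f : C -> C) z g df :
  is_derive (f z) 1 G g -> is_derive z 1 f df ->
  is_derive z 1 (fun w => G (f w)) (g * df).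
Proof.
move=> /is_derive_Caratheodory[phi [cphi <- H]] dfz.
have cf := is_derive_cvg dfz.
move: dfz => /is_derive_Caratheodory[psi [cpsi <- K]].
apply: (@Caratheodory_is_derive _ (fun w => phi (f w) * psi w)).
  by apply: cvgC_M cpsi; exact: (cvg_comp _ _ cf cphi).
by apply/nearCP; exists 1 => // w _; rewrite H K mulrA.
Qed.

(** Stated by real and imaginary parts, to match [velocity] and to apply the real mean value theorem
    and the real fundamental theorem of calculus. [curve_derivP] gives back the complex difference
    quotient. *)
Definition curve_deriv (p : R -> C) (t : R) (v : C) :=
  is_derive t 1 (fun u => Re (p u)) (Re v) /\ is_derive t 1 (fun u => Im (p u)) (Im v).

Lemma curve_derivP (p : R -> C) t v : curve_deriv p t v <->
  ((h^-1)%:C : C) * (p (h + t) - p t) @[h --> 0^'] --> v.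
Proof.
have E (q : R -> R) a : is_derive t 1 q a <->
    h^-1 * (q (h + t) - q t) @[h --> 0^'] --> a.
  have eq1 : (fun h => h^-1 *: (q (h *: 1 + t) - q t)) = (fun h => h^-1 * (q (h + t) - q t)).
    by apply/funext => h; rewrite /GRing.scale /= mulr1.
  split=> [[dq <-]|H]; first by rewrite -eq1; exact: dq.
  rewrite -eq1 in H.
  apply: DeriveDef; last exact/cvg_lim.
  by apply/cvg_ex; exists a.
rewrite /curve_deriv !E.
have e1 : (fun h => h^-1 * (Re (p (h + t)) - Re (p t))) =
    (fun h => Re ((h^-1)%:C * (p (h + t) - p t))).
  by apply/funext => h; rewrite ReM /= mul0r subr0 ReB.
have e2 : (fun h => h^-1 * (Im (p (h + t)) - Im (p t))) =
    (fun h => Im ((h^-1)%:C * (p (h + t) - p t))).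
  by apply/funext => h; rewrite ImM /= mul0r addr0 ImB.
rewrite e1 e2; split; last exact: (cvgCP _ _).1.
by move=> H; exact: (cvgCP _ _).2.
Qed.

Lemma cvg_dnbhs_shift t : (h + t : R) @[h --> (0 : R)^'] --> t.
Proof.
have H : (h + t : R) @[h --> (0 : R)] --> 0 + t.
  by apply: cvgD; [exact: cvg_id|exact: cvg_cst].
by rewrite add0r in H; exact: cvg_within_filter H.
Qed.

Lemma is_derive_compR (f g : R -> R) t df dg :
  is_derive (g t) 1 f df -> is_derive t 1 g dg ->
  is_derive t 1 (fun u => f (g u)) (df * dg).
Proof.
move=> Df Dg; have [Df' Ef] := Df; have [Dg' Eg] := Dg; apply: DeriveDef.
  have df' := (derivable1_diffP f (g t)).1 Df'.
  have dg' := (derivable1_diffP g t).1 Dg'.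
  exact: (derivable1_diffP _ _).2 (differentiable_comp dg' df').
by rewrite -derive1E (derive1_comp Dg' Df') !derive1E Ef Eg.
Qed.

Lemma curve_deriv_cvg (p : R -> C) t v : curve_deriv p t v -> p u @[u --> t] --> p t.
Proof.
move=> [rp ip]; apply/cvgCP; split.
  exact/differentiable_continuous/derivable1_diffP.
exact/differentiable_continuous/derivable1_diffP.
Qed.

Lemma curve_deriv_comp (G : C -> C) (p : R -> C) t v g :
  is_derive (p t) 1 G g -> curve_deriv p t v ->
  curve_deriv (fun u => G (p u)) t (g * v).
Proof.
move=> /is_derive_Caratheodory[phi [cphi <- H]] dp.
have cp := curve_deriv_cvg dp.
move/curve_derivP : dp => dp; apply/curve_derivP.
have -> : (fun h : R => (h^-1)%:C * (G (p (h + t)) - G (p t))) =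
   (fun h => phi (p (h + t)) * ((h^-1)%:C * (p (h + t) - p t))).
  by apply/funext => h; rewrite H mulrCA.
apply: cvgM dp.
have cs := @cvg_dnbhs_shift t.
exact: (cvg_comp _ _ (cvg_comp _ _ cs cp) cphi).
Qed.

Lemma curve_derivD (p q : R -> C) t v w : curve_deriv p t v -> curve_deriv q t w ->
  curve_deriv (fun u => p u + q u) t (v + w).
Proof.
move=> [rp ip] [rq iq]; rewrite /curve_deriv ReD ImD.
by split; [under eq_fun do rewrite ReD|under eq_fun do rewrite ImD]; exact: is_deriveD.
Qed.

Lemma curve_derivM (p q : R -> C) t v w : curve_deriv p t v -> curve_deriv q t w ->
  curve_deriv (fun u => p u * q u) t (v * q t + p t * w).
Proof.
move=> dp dq; have cq := curve_deriv_cvg dq.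
move/curve_derivP : dp => dp; move/curve_derivP : dq => dq; apply/curve_derivP.
have cs := @cvg_dnbhs_shift t.
have -> : (fun h : R => (h^-1)%:C * (p (h + t) * q (h + t) - p t * q t)) =
   (fun h => (h^-1)%:C * (p (h + t) - p t) * q (h + t) +
             p t * ((h^-1)%:C * (q (h + t) - q t))).
  by apply/funext => h; ring.
have c1 := cvgM dp (cvg_comp _ _ cs cq).
have c2 := cvgM (@cvg_cst C (p t) R (0^') _) dq.
have FF := @dnbhs_filter R 0.
exact: (@cvgD _ _ _ _ FF _ _ _ _ (c1 FF) (c2 FF FF)).
Qed.

Lemma curve_deriv_cst (a : C) t : curve_deriv (fun=> a) t 0.
Proof. by split; exact: is_derive_cst. Qed.

Lemma curve_deriv_real t : curve_deriv (fun u => u%:C) t 1.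
Proof. by split; [exact: is_derive_id|exact: is_derive_cst]. Qed.

Lemma curve_deriv_affine (a b : C) t : curve_deriv (fun u => a + u%:C * b) t b.
Proof.
have := curve_derivD (curve_deriv_cst a t)
  (curve_derivM (curve_deriv_real t) (curve_deriv_cst b t)).
by rewrite mulr0 addr0 add0r mul1r.
Qed.

Lemma velocityE (p : R -> C) t v : curve_deriv p t v -> velocity p t = v.
Proof.
move=> [rp ip]; rewrite /velocity !derive1E.
by rewrite (@derive_val _ _ _ _ _ _ _ rp) (@derive_val _ _ _ _ _ _ _ ip); case: v {rp ip}.
Qed.

(** The intermediate points for the real and the imaginary part may differ, so the mean value
    theorem is applied to each part; this costs the factor 2. *)
Lemma curve_mean_value (p d : R -> C) (M : R) :
  (forall t, 0 <= t <= 1 -> curve_deriv p t (d t)) ->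
  (forall t, 0 <= t <= 1 -> `|d t| <= M%:C) ->
  `|p 1 - p 0| <= (M *+ 2)%:C.
Proof.
move=> dp dM; rewrite mulr2n; apply: le_trans (normC_le _) _.
have key (q dq : R -> R) :
    (forall t, 0 <= t <= 1 -> is_derive t 1 q (dq t)) ->
    (forall t, 0 <= t <= 1 -> `|dq t| <= M) -> `|q 1 - q 0| <= M.
  move=> Dq DM; have [|||c c01 ->] := @MVT R q dq 0 1.
  - exact: ltr01.
  - by move=> x; rewrite in_itv /= => /andP[? ?]; apply: Dq; rewrite !ltW.
  - by apply: derivable_within_continuous => x; rewrite in_itv /= => /Dq[].
  - rewrite subr0 mulr1; apply: DM; move: c01; rewrite in_itv /= => /andP[? ?].
    by rewrite !ltW.
rewrite lecR; apply: lerD.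
  rewrite ReB; apply: (key (fun u => Re (p u)) (fun u => Re (d u))) => t t01.
    exact: (dp t t01).1.
  by rewrite -lecR (le_trans (normC_Re _)) ?dM.
rewrite ImB; apply: (key (fun u => Im (p u)) (fun u => Im (d u))) => t t01.
  exact: (dp t t01).2.
by rewrite -lecR (le_trans (normC_Im _)) ?dM.
Qed.

(** Only the derivative along real rays is computed from [expR], [cos] and [sin]; the complex
    derivative is deduced from estimates along rays. *)
Lemma curve_deriv_cexp z t : curve_deriv (fun u => cexp (u%:C * z)) t (z * cexp (t%:C * z)).
Proof.
pose a := Re z; pose b := Im z.
have eR : (fun u => Re (cexp (u%:C * z))) = (fun u => expR (u * a) * cos (u * b)).
  by apply/funext => u; rewrite Re_cexp !ReImE /= !mul0r subr0 addr0.
have eI : (fun u => Im (cexp (u%:C * z))) = (fun u => expR (u * a) * sin (u * b)).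
  by apply/funext => u; rewrite Im_cexp !ReImE /= !mul0r subr0 addr0.
have dl (k : R) : is_derive t 1 (fun u => u * k) k.
  apply: is_derive_eq; last by rewrite scaler0 add0r /GRing.scale /= mulr1.
have de : is_derive t 1 (fun u => expR (u * a)) (expR (t * a) * a).
  by apply: is_derive_compR.
have dc : is_derive t 1 (fun u => cos (u * b)) (- sin (t * b) * b).
  by apply: is_derive_compR.
have ds : is_derive t 1 (fun u => sin (u * b)) (cos (t * b) * b).
  by apply: is_derive_compR.
have Et : Re (t%:C * z) = t * a by rewrite ReM /= mul0r subr0.
have Ei : Im (t%:C * z) = t * b by rewrite ImM /= mul0r addr0.
split; rewrite ?eR ?eI.
  apply: is_derive_eq; rewrite /GRing.scale ReM Re_cexp Im_cexp Et Ei -/a -/b /=.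
  by ring.
apply: is_derive_eq; rewrite /GRing.scale ImM Re_cexp Im_cexp Et Ei -/a -/b /=.
by ring.
Qed.

End Derivatives.

(** * The exponential *)

Section ComplexExponential.
Variable R : realType.
Local Notation C := (Cx R).
Local Notation Re := (@complex.Re R).
Local Notation Im := (@complex.Im R).
Implicit Types (z w : C) (t r : R).

Definition modulus z : R := Re `|z|.

Lemma modulusE z : `|z| = (modulus z)%:C. Proof. exact: normC_real. Qed.

Lemma modulus_ge0 z : 0 <= modulus z.
Proof. by rewrite -lecR -modulusE normr_ge0. Qed.

Lemma modulusM z w : modulus (z * w) = modulus z * modulus w.
Proof. by apply: (@complexI R); rewrite rmorphM -!modulusE normrM. Qed.

Lemma modulus_realC t : modulus (t%:C) = `|t|.
Proof. by apply: (@complexI R); rewrite -modulusE real_complex_norm. Qed.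

Lemma modulusX z n : modulus (z ^+ n) = modulus z ^+ n.
Proof. by apply: (@complexI R); rewrite rmorphXn -!modulusE normrX. Qed.

Lemma modulus_cexp z : modulus (cexp z) = expR (Re z).
Proof.
rewrite /modulus /= !exprMn -mulrDr cos2Dsin2 mulr1 sqrtr_sqr.
by rewrite ger0_norm ?expR_ge0.
Qed.

Lemma Re_le_modulus z : Re z <= modulus z.
Proof. by apply: le_trans (ler_norm _) _; rewrite -lecR -modulusE normC_Re. Qed.

Lemma modulus_cexp_le z : modulus (cexp z) <= expR (modulus z).
Proof. by rewrite modulus_cexp ler_expR Re_le_modulus. Qed.

Lemma modulus_scale_le z t : 0 <= t <= 1 -> modulus (t%:C * z) <= modulus z.
Proof.
move=> /andP[t0 t1]; rewrite modulusM modulus_realC ger0_norm//.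
by rewrite ler_piMl ?modulus_ge0.
Qed.

Lemma cexp_sub1_le z : modulus (cexp z - 1) <= 2 * modulus z * expR (modulus z).
Proof.
rewrite -lecR -modulusE -cexp0.
have := @curve_mean_value R (fun u => cexp (u%:C * z)) _ (modulus z * expR (modulus z))
  (fun t _ => curve_deriv_cexp z t).
rewrite mul1r mul0r => H; apply: le_trans (H _) _.
  move=> t t01; rewrite modulusE lecR modulusM ler_wpM2l ?modulus_ge0//.
  by rewrite (le_trans (modulus_cexp_le _))// ler_expR modulus_scale_le.
by rewrite lecR -mulrA mulr_natl.
Qed.

(** The mean value bound for u |-> cexp(u z) - u z, whose derivative z (cexp(u z) - 1) is controlled
    by [cexp_sub1_le]. *)
Lemma cexp_sub1_sub_le z :
  modulus (cexp z - 1 - z) <= 4 * modulus z ^+ 2 * expR (modulus z).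
Proof.
have dq t : curve_deriv (fun u => cexp (u%:C * z) + u%:C * (- z)) t
    (z * (cexp (t%:C * z) - 1)).
  have := curve_derivD (curve_deriv_cexp z t)
    (curve_derivM (curve_deriv_real t) (curve_deriv_cst (- z) t)).
  by rewrite mulr0 addr0 mul1r mulrBr mulr1.
have := @curve_mean_value R _ _ (modulus z * (2 * modulus z * expR (modulus z)))
  (fun t _ => dq t).
rewrite mul1r !mul0r cexp0 addr0 mul1r => H.
rewrite -lecR -modulusE addrAC; apply: le_trans (H _) _.
  move=> t t01; rewrite modulusE lecR modulusM ler_wpM2l ?modulus_ge0//.
  apply: le_trans (cexp_sub1_le _) _; apply: ler_pM.
  - by rewrite mulr_ge0 ?modulus_ge0.
  - exact: expR_ge0.
  - by rewrite ler_wpM2l ?modulus_scale_le.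
  - by rewrite ler_expR modulus_scale_le.
by rewrite lecR le_eqVlt; apply/orP; left; apply/eqP; ring.
Qed.

Lemma is_derive_cexp z : is_derive z 1 (fun w => cexp w) (cexp z).
Proof.
pose phi w := if w == z then cexp z else (cexp w - cexp z) / (w - z).
have -> : cexp z = phi z by rewrite /phi eqxx.
apply: Caratheodory_is_derive; last first.
  apply/nearCP; exists 1 => // w _; rewrite /phi; case: eqP => [->|/eqP wz].
    by rewrite !subrr mulr0.
  by rewrite divfK// subr_eq0.
rewrite {2}/phi eqxx; apply/(@cvgCdistP _ _ (nbhs z)) => r r0; apply/nearCP.
(* The factor [expR (Re z)] is the modulus of [cexp z], taken out of the difference; [4 * expR 1]
   bounds the quadratic remainder at [w - z] when its modulus is below 1. *)
pose K : R := 4 * expR (Re z) * expR 1.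
have K0 : 0 < K by rewrite !mulr_gt0// expR_gt0.
exists (Num.min 1 (r / K)); first by rewrite lt_min ltr01 divr_gt0.
move=> w; rewrite modulusE ltcR lt_min => /andP[w1 wr].
rewrite /phi; have [_|wz] := eqVneq w z; first by rewrite subrr normr0 ltcR.
have wz0 : w - z != 0 by rewrite subr_eq0.
rewrite modulusE ltcR.
have -> : (cexp w - cexp z) / (w - z) - cexp z =
    cexp z * ((cexp (w - z) - 1 - (w - z)) / (w - z)).
  have -> : cexp w = cexp z * cexp (w - z) by rewrite -cexpD addrC subrK.
  by field.
rewrite modulusM modulus_cexp modulusM.
have m0 : 0 < modulus (w - z) by rewrite -ltcR -modulusE normr_gt0.
have -> : modulus (w - z)^-1 = (modulus (w - z))^-1.
  by apply: (@complexI R); rewrite fmorphV -!modulusE normfV.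
have H := cexp_sub1_sub_le (w - z).
apply: (@le_lt_trans _ _ (K * modulus (w - z))); last by rewrite mulrC -ltr_pdivlMr.
have E1 : expR (modulus (w - z)) <= expR 1 by rewrite ler_expR ltW.
have -> : K * modulus (w - z) =
    expR (Re z) * ((4 * modulus (w - z) ^+ 2 * expR 1) / modulus (w - z)).
  by rewrite /K; field; rewrite gt_eqF.
rewrite ler_pM2l ?expR_gt0// ler_pM2r ?invr_gt0// (le_trans H)//.
by rewrite ler_pM2l// mulr_gt0// exprn_gt0.
Qed.


End ComplexExponential.

(** * The exponential series, and [mexp] of diagonal and of nilpotent 2 x 2 matrices *)

Section MatrixExponential.
Variable R : realType.
Local Notation C := (Cx R).
Implicit Types (z w : C) (t r : R).

Definition expsum z : nat -> C := series (fun k => (k`!%:R)^-1 * z ^+ k).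

Lemma expsumS z n : expsum z n.+1 = expsum z n + (n`!%:R)^-1 * z ^+ n.
Proof. by rewrite /expsum !seriesEnat /= big_nat_recr. Qed.

Lemma expsum1 z : expsum z 1 = 1.
Proof. by rewrite expsumS /expsum seriesEnat /= big_nil add0r expr0 invr1 mulr1. Qed.

Lemma curve_deriv_scale_pow z n t :
  curve_deriv (fun u => (u%:C * z) ^+ n.+1) t (n.+1%:R * z * (t%:C * z) ^+ n).
Proof.
have dl : curve_deriv (fun u => u%:C * z) t z.
  have := curve_derivM (curve_deriv_real t) (curve_deriv_cst z t).
  by rewrite mulr0 addr0 mul1r.
elim: n => [|n IH].
  by rewrite expr0 mulr1 mul1r; under [X in curve_deriv X]eq_fun do rewrite expr1.
under [X in curve_deriv X]eq_fun do rewrite exprS.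
have := curve_derivM dl IH.
suff -> : z * (t%:C * z) ^+ n.+1 + t%:C * z * (n.+1%:R * z * (t%:C * z) ^+ n) =
  n.+2%:R * z * (t%:C * z) ^+ n.+1 by [].
by rewrite !exprS -[n.+2%:R]natr1; ring.
Qed.

(** [expsum z n] has n terms, and differentiation loses one. This defect leaves a single monomial in
    the derivative of the product with cexp(- u z). *)
Lemma curve_deriv_expsum z n t :
  curve_deriv (fun u => expsum (u%:C * z) n.+1) t (z * expsum (t%:C * z) n).
Proof.
elim: n => [|n IH].
  under [X in curve_deriv X]eq_fun do rewrite expsum1.
  rewrite /expsum seriesEnat /= big_nil mulr0; exact: curve_deriv_cst.
under [X in curve_deriv X]eq_fun do rewrite expsumS.
have := curve_derivD IH (curve_derivM (curve_deriv_cst ((n.+1)`!%:R)^-1 t)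
  (curve_deriv_scale_pow z n t)).
suff -> : z * expsum (t%:C * z) n + (0 * (t%:C * z) ^+ n.+1 +
    ((n.+1)`!%:R)^-1 * (n.+1%:R * z * (t%:C * z) ^+ n)) =
    z * expsum (t%:C * z) n.+1 by [].
have f0 k : (k`!%:R : C) != 0 by rewrite pnatr_eq0 -lt0n fact_gt0.
rewrite mul0r add0r expsumS factS natrM; field.
by rewrite (f0 n) nat1r pnatr_eq0.
Qed.

(* The derivative of [u |-> cexp (- u z) * expsum (u z) n.+1] is
   [- z cexp (- u z) (u z)^n / n!]. *)
Lemma expsum_error z n :
  modulus (expsum z n.+1 * cexp (- z) - 1) <=
  2 * modulus z * expR (modulus z) * exp_coeff (modulus z) n.
Proof.
have f0 k : (k`!%:R : C) != 0 by rewrite pnatr_eq0 -lt0n fact_gt0.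
have dq t : curve_deriv (fun u => expsum (u%:C * z) n.+1 * cexp (u%:C * (- z))) t
    (- (z * cexp (t%:C * (- z)) * (t%:C * z) ^+ n / n`!%:R)).
  have := curve_derivM (curve_deriv_expsum z n t) (curve_deriv_cexp (- z) t).
  suff -> : z * expsum (t%:C * z) n * cexp (t%:C * - z) +
     expsum (t%:C * z) n.+1 * (- z * cexp (t%:C * - z)) =
     - (z * cexp (t%:C * (- z)) * (t%:C * z) ^+ n / n`!%:R) by [].
  by rewrite expsumS; ring.
have := @curve_mean_value R _ _
  (modulus z * expR (modulus z) * exp_coeff (modulus z) n) (fun t _ => dq t).
rewrite !mul1r !mul0r cexp0.
have -> : expsum 0 n.+1 = 1.
  elim: n {dq} => [|n IH]; first exact: expsum1.
  by rewrite expsumS IH expr0n mulr0 addr0.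
rewrite mulr1 => H; rewrite -lecR -modulusE; apply: le_trans (H _) _; last first.
  by rewrite lecR le_eqVlt; apply/orP; left; apply/eqP; ring.
move=> t t01; rewrite normrN modulusE lecR !modulusM -!mulrA.
have -> : (n`!%:R : C) = (n`!%:R : R)%:C by rewrite rmorph_nat.
rewrite -fmorphV modulus_realC ger0_norm ?invr_ge0//.
have mX : modulus ((t%:C * z) ^+ n) <= modulus z ^+ n.
  by rewrite modulusX lerXn2r ?nnegrE ?modulus_ge0// modulus_scale_le.
rewrite ler_wpM2l ?modulus_ge0// ler_pM ?modulus_ge0//.
- by rewrite mulr_ge0 ?modulus_ge0 ?invr_ge0.
- rewrite (le_trans (modulus_cexp_le _))// ler_expR.
  rewrite (le_trans (modulus_scale_le _ t01))//.
  by rewrite -lecR -!modulusE normrN.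
- by rewrite /exp_coeff /= ler_wpM2r ?invr_ge0.
Qed.

(** The error in [expsum_error] is a constant times the general term of a convergent real
    exponential series, hence tends to 0. Multiplying by [cexp z] undoes the factor [cexp (- z)]. *)
Lemma cvg_expsum z : expsum z n @[n --> \oo] --> cexp z.
Proof.
rewrite -(cvg_shiftS (expsum z)).
have H : expsum z n.+1 * cexp (- z) @[n --> \oo] --> (1 : C).
  apply/cvgCdistP => r r0.
  pose K := 2 * modulus z * expR (modulus z).
  have K0 : 0 <= K by rewrite !mulr_ge0 ?modulus_ge0 ?expR_ge0.
  have c0 : K * exp_coeff (modulus z) n @[n --> \oo] --> 0.
    rewrite -[X in _ --> X](mulr0 K); apply: cvgM; first exact: cvg_cst.
    exact: cvg_series_cvg_0 (is_cvg_series_exp_coeff _).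
  move/cvgrPdist_lt : c0 => /(_ r r0); apply: filterS => n.
  rewrite sub0r normrN ger0_norm ?mulr_ge0 ?exp_coeff_ge0 ?exprn_ge0 ?invr_ge0 ?modulus_ge0// => h.
  by rewrite modulusE ltcR (le_lt_trans (expsum_error _ _)).
have -> : [sequence expsum z n.+1]_n = (fun n => expsum z n.+1 * cexp (- z) * cexp z).
  by apply/funext => n; rewrite -mulrA cexpNM mulr1.
have := cvgM H (cvg_cst (cexp z)).
by rewrite mul1r; apply; exact: fmap_filter.
Qed.

Lemma mx2E (a b c d : C) : mx2 a b c d =
  a *: delta_mx 0 0 + b *: delta_mx 0 1 + c *: delta_mx 1 0 + d *: delta_mx 1 1.
Proof.
apply/matrixP => i j; rewrite !mxE.
by case: i => [[|[|//]] ?]; case: j => [[|[|//]] ?] /=;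
  rewrite !(mulr0, mulr1, addr0, add0r).
Qed.

Lemma mx2_mul (a b c d a' b' c' d' : C) : mx2 a b c d *m mx2 a' b' c' d' =
  mx2 (a * a' + b * c') (a * b' + b * d') (c * a' + d * c') (c * b' + d * d').
Proof.
apply/matrixP => i j; rewrite !mxE big_ord_recl big_ord1 !mxE.
by case: i => [[|[|//]] ?]; case: j => [[|[|//]] ?].
Qed.

Lemma mx2_add (a b c d a' b' c' d' : C) : mx2 a b c d + mx2 a' b' c' d' =
  mx2 (a + a') (b + b') (c + c') (d + d').
Proof.
by apply/matrixP => i j; rewrite !mxE;
  case: i => [[|[|//]] ?]; case: j => [[|[|//]] ?].
Qed.

Lemma mx2_scale (k a b c d : C) : k *: mx2 a b c d = mx2 (k * a) (k * b) (k * c) (k * d).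
Proof.
by apply/matrixP => i j; rewrite !mxE;
  case: i => [[|[|//]] ?]; case: j => [[|[|//]] ?].
Qed.

Lemma mx2_1 : mx2 1 0 0 1 = 1 :> 'M[C]_2.
Proof.
by apply/matrixP => i j; rewrite !mxE;
  case: i => [[|[|//]] ?]; case: j => [[|[|//]] ?].
Qed.

Lemma mx2_0 : mx2 0 0 0 0 = 0 :> 'M[C]_2.
Proof.
by apply/matrixP => i j; rewrite !mxE;
  case: i => [[|[|//]] ?]; case: j => [[|[|//]] ?].
Qed.

Lemma mx2_unit (a b d : C) : a != 0 -> d != 0 -> mx2 a b 0 d \in unitmx.
Proof.
move=> a0 d0; apply: (proj1 (@mulmx1_unit _ _ _ (mx2 a^-1 (- (b / (a * d))) 0 d^-1) _)).
rewrite mx2_mul -[RHS]mx2_1; congr mx2; rewrite ?mulr0 ?mul0r ?addr0 ?add0r ?mulfV//.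
by field; rewrite a0 d0.
Qed.

Lemma cvg_mx2 {T : Type} (F : set_system T) {FF : Filter F} (f g : T -> C) (a d : C) :
  f x @[x --> F] --> a -> g x @[x --> F] --> d ->
  mx2 (f x) 0 0 (g x) @[x --> F] --> mx2 a 0 0 d.
Proof.
move=> fa gd.
have E (u v : C) : mx2 u 0 0 v = u *: delta_mx 0 0 + v *: delta_mx 1 1.
  by rewrite mx2E !scale0r !addr0.
have -> : (fun x => mx2 (f x) 0 0 (g x)) =
    (fun x => f x *: delta_mx 0 0 + g x *: delta_mx 1 1).
  by apply/funext => x; rewrite E.
rewrite E.
have c1 := @cvgZr_tmp _ _ _ F FF f a (delta_mx 0 0 : 'M[C]_2) fa.
have c2 := @cvgZr_tmp _ _ _ F FF g d (delta_mx 1 1 : 'M[C]_2) gd.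
exact: (@cvgD _ _ _ _ FF _ _ _ _ c1 c2).
Qed.

Lemma mexp_diag (a d : C) : mexp (mx2 a 0 0 d) = mx2 (cexp a) 0 0 (cexp d).
Proof.
rewrite /mexp; apply: cvg_lim; first exact: norm_hausdorff.
have pw k : mx2 a 0 0 d ^+ k = mx2 (a ^+ k) 0 0 (d ^+ k).
  elim: k => [|k IH]; first by rewrite !expr0 mx2_1.
  by rewrite !exprS IH [LHS]mx2_mul !(mulr0, mul0r, addr0, add0r).
have -> : series (fun k => (k`!%:R^-1 : C) *: mx2 a 0 0 d ^+ k) =
    fun n => mx2 (expsum a n) 0 0 (expsum d n).
  apply/funext; elim => [|n IH].
    by rewrite /expsum !seriesEnat /= !big_nil mx2_0.
  rewrite !expsumS /series /= big_nat_recr//= -[X in X + _]/(series _ n) IH.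
  by rewrite pw mx2_scale mx2_add !mulr0 !addr0.
exact: (@cvg_mx2 nat \oo eventually_filter _ _ _ _ (@cvg_expsum a) (@cvg_expsum d)).
Qed.

Lemma mexp_nilpotent (b : C) : mexp (mx2 0 b 0 0) = mx2 1 b 0 1.
Proof.
have pw k : mx2 0 b 0 0 ^+ k.+2 = 0.
  rewrite !exprS mulrA -[X in X * _]/(_ *m _) mx2_mul !(mulr0, mul0r, addr0).
  by rewrite mx2_0 mul0r.
rewrite /mexp; apply: lim_near_cst; first exact: norm_hausdorff.
(* The square of the matrix vanishes, so the partial sums are constant from index 2 on. *)
exists 2%N => // -[//|[//|n]] _.
rewrite seriesEnat /= big_nat_recl// big_nat_recl// big1 ?addr0; last first.
  by move=> k _; rewrite pw scaler0.
by rewrite expr0 expr1 invr1 !scale1r -mx2_1 mx2_add !(addr0, add0r).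
Qed.

End MatrixExponential.

(** * Logarithms *)

Section Logarithms.
Variable R : realType.
Local Notation C := (Cx R).
Local Notation Re := (@complex.Re R).
Local Notation Im := (@complex.Im R).
Implicit Types (z w x b c : C) (t r : R).

(** With [phi] the Caratheodory factor of [cexp] at [L x], phi(L w) (L w - L x) = c (w - x), so c /
    phi(L w) is a Caratheodory factor of [L]. Continuity of [L] keeps the denominator nonzero near
    [x]. The constant [c] covers logarithms of b - x and of multiples of x - b. *)
Lemma is_derive_log (L : C -> C) c b x : c != 0 ->
  L w @[w --> x] --> L x ->
  (\forall w \near x, cexp (L w) = c * (w - b)) ->
  is_derive x 1 L (x - b)^-1.
Proof.
move=> c0 cL /nearCP[d d0 eL].
have eLx : cexp (L x) = c * (x - b) by apply: eL; rewrite subrr normr0 ltcR.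
have [phi [cphi phix H]] := is_derive_Caratheodory (is_derive_cexp (L x)).
have phi0 : phi (L x) != 0 by rewrite phix cexp_neq0.
have cphiL : phi (L w) @[w --> x] --> phi (L x) by exact: (cvg_comp _ _ cL cphi).
have -> : (x - b)^-1 = c / phi (L x).
  by rewrite phix eLx invfM mulrA divff// mul1r.
apply: (@Caratheodory_is_derive _ _ (fun w => c / phi (L w))).
  exact: cvgC_M (@cvgC_cst _ x c) (cvgC_V phi0 cphiL).
have m0 : 0 < modulus (phi (L x)) by rewrite -ltcR -modulusE normr_gt0.
have [e e0 He] := (nearCP _ _).1 ((@cvgCdistP _ _ (nbhs x) _ _ _).1 cphiL _ m0).
apply/nearCP; exists (Num.min d e); first by rewrite lt_min d0.
move=> w; rewrite modulusE ltcR lt_min => /andP[wd we].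
have {}we : `|phi (L w) - phi (L x)| < (modulus (phi (L x)))%:C.
  by apply: He; rewrite modulusE ltcR.
have pw0 : phi (L w) != 0.
  by apply/eqP => pw; move: we; rewrite pw sub0r normrN modulusE ltxx.
have := H (L w); rewrite eLx eL; last by rewrite modulusE ltcR.
rewrite -mulrBr opprB addrA subrK => cwx.
by rewrite mulrAC cwx mulrAC divff// mul1r.
Qed.

(* The principal logarithm on the half-plane [0 < Re z]; junk elsewhere. *)
Definition Log z : C := ln (modulus z) +i* atan (Im z / Re z).

Lemma cexp_Log z : 0 < Re z -> cexp (Log z) = z.
Proof.
case: z => a b /= a0; pose u := b / a.
have m0 : 0 < modulus (a +i* b).
  by rewrite (lt_le_trans a0)// -[X in X <= _]/(Re (a +i* b)) Re_le_modulus.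
have mE : modulus (a +i* b) = a * Num.sqrt (1 + u ^+ 2).
  rewrite /modulus /= -[X in X * _](ger0_norm (ltW a0)) -sqrtr_sqr -sqrtrM ?sqr_ge0//.
  congr Num.sqrt; rewrite /u; field; by rewrite gt_eqF.
have s0 : 0 < Num.sqrt (1 + u ^+ 2) by rewrite sqrtr_gt0 ltr_pwDl// sqr_ge0.
have ca : cos (atan u) = (Num.sqrt (1 + u ^+ 2))^-1 by rewrite cos_atan.
have sa : sin (atan u) = u / Num.sqrt (1 + u ^+ 2).
  have tu := atanK u; rewrite /tan ca invrK in tu.
  by apply: (mulIf (lt0r_neq0 s0)); rewrite tu divfK ?gt_eqF.
rewrite /cexp /Log /= lnK ?posrE// -/u ca sa mE.
apply/complex_eqP => /=; split; first by rewrite mulfK// gt_eqF.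
by rewrite /u; field; rewrite gt_eqF//= gt_eqF.
Qed.

Lemma Im_Log_lt z : `|Im (Log z)| < pi / 2.
Proof. by rewrite ltr_norml atan_gtNpi2 atan_ltpi2. Qed.

Lemma Log_cvg z : 0 < Re z -> Log w @[w --> z] --> Log z.
Proof.
move=> z0; have m0 : 0 < modulus z by rewrite (lt_le_trans z0)// Re_le_modulus.
have cid := @cvgC_id _ z.
have cm : modulus w @[w --> z] --> modulus z.
  apply: (@cvg_Re _ _ (nbhs z) _ (fun w : C => (`|w| : C)) `|z|).
  exact: (@cvg_norm _ _ _ (nbhs z) _ _ _ cid).
apply/(@cvgCP _ _ (nbhs z)); split => /=.
  exact: (cvg_comp _ _ cm (continuous_ln m0)).
have FF : Filter (nbhs z) by exact: nbhs_filter.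
have cr := @cvg_Re _ _ (nbhs z) FF _ _ cid.
have ci := @cvg_Im _ _ (nbhs z) FF _ _ cid.
have cV := @cvgV _ _ (nbhs z) FF _ _ (lt0r_neq0 z0) cr.
have cq := @cvgM _ _ (nbhs z) FF _ _ _ _ ci cV.
exact: (cvg_comp _ _ cq (@continuous_atan R (Im z / Re z))).
Qed.

(** The ratio minus 1 is (x - y) / (y - b), of modulus below 1. So the principal logarithm of the
    ratio is available on the whole disc around [y] that reaches up to [b]. *)
Lemma Re_ratio_gt0 x y b : `|x - y| < `|y - b| -> 0 < Re ((x - b) / (y - b)).
Proof.
move=> xy; have yb0 : 0 < `|y - b| by exact: le_lt_trans xy.
have yb : y - b != 0 by rewrite -normr_gt0.
have h1 : `|(x - b) / (y - b) - 1| < 1.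
  have -> : (x - b) / (y - b) - 1 = (x - y) / (y - b) by field.
  by rewrite normrM normfV ltr_pdivrMr// mul1r.
have : `|Re ((x - b) / (y - b)) - 1| < 1.
  by rewrite -ltcR -Re1 -ReB (le_lt_trans (normC_Re _)).
by rewrite ltr_norml => /andP[h _]; lra.
Qed.

(** The analytic logarithm of a multiple of x - b that takes the value [v] at [y], meaningful on the
    disc around [y] whose boundary passes through [b]. *)
Definition local_log (v y b x : C) : C := v + Log ((x - b) / (y - b)).

Lemma cexp_local_log v y b x : `|x - y| < `|y - b| ->
  cexp (local_log v y b x) = cexp v * ((x - b) / (y - b)).
Proof. by move=> xy; rewrite /local_log cexpD cexp_Log// Re_ratio_gt0. Qed.

Lemma is_derive_local_log v y b x : `|x - y| < `|y - b| ->
  is_derive x 1 (local_log v y b) (x - b)^-1.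
Proof.
move=> xy; have yb0 : 0 < `|y - b| by exact: le_lt_trans xy.
have yb : y - b != 0 by rewrite -normr_gt0.
apply: (@is_derive_log _ (cexp v / (y - b))).
- by rewrite mulf_neq0 ?cexp_neq0 ?invr_neq0.
- rewrite /local_log; apply: cvgC_D (@cvgC_cst _ x v) _.
  have c : (w - b) / (y - b) @[w --> x] --> (x - b) / (y - b).
    exact: cvgC_M (cvgC_B (@cvgC_id _ x) (@cvgC_cst _ x b)) (@cvgC_cst _ x _).
  exact: (cvg_comp _ _ c (Log_cvg (Re_ratio_gt0 xy))).
- apply/nearCP; exists (modulus (y - b) - modulus (x - y)).
    by rewrite subr_gt0 -ltcR -!modulusE.
  move=> w wx; rewrite cexp_local_log; last first.
    rewrite -(subrK x w) -addrA (le_lt_trans (ler_normD _ _))//.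
    move: wx; rewrite !modulusE -rmorphD !ltcR; lra.
  by rewrite mulrA mulrAC.
Qed.

(** Both sides are logarithms of the same number c (x - b). Each [Log] contributes less than pi/2 to
    the imaginary part of the difference and the centre values less than pi, so [cexp_eq1]
    applies. *)
Lemma local_log_inj v v' y y' b c x : c != 0 ->
  `|x - y| < `|y - b| -> `|x - y'| < `|y' - b| ->
  cexp v = c * (y - b) -> cexp v' = c * (y' - b) -> `|Im (v - v')| < pi ->
  local_log v y b x = local_log v' y' b x.
Proof.
move=> c0 xy xy' ev ev' vv'.
have nz u : `|x - u| < `|u - b| -> u - b != 0.
  by move=> xu; rewrite -normr_gt0 (le_lt_trans _ xu).
have yb := nz _ xy; have yb' := nz _ xy'.
have xb : x - b != 0.
  by apply: contraTneq xy => /subr0_eq ->; rewrite distrC ltxx.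
apply/eqP; rewrite -subr_eq0; apply/eqP/cexp_eq1.
  rewrite cexpB !cexp_local_log// ev ev'.
  by field; rewrite yb yb' c0 xb.
rewrite /local_log.
set A := Log _; set B := Log _.
have -> : Im (v + A - (v' + B)) = Im (v - v') + (Im A - Im B) by rewrite !ReImE; ring.
have hA : `|Im A| < pi / 2 by exact: Im_Log_lt.
have hB : `|Im B| < pi / 2 by exact: Im_Log_lt.
apply: le_lt_trans (ler_normD _ _) _; apply: (@lt_le_trans _ _ (pi + (pi / 2 + pi / 2))).
  by rewrite ltrD// (le_lt_trans (ler_normB _ _))// ltrD.
by rewrite mulr2n -splitr.
Qed.

Lemma local_log_center v b x : x != b -> local_log v x b x = v.
Proof.
move=> xb; rewrite /local_log divff ?subr_eq0// (_ : Log 1 = 0) ?addr0//.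
have -> : (1 : C) = (1 : R)%:C by [].
by rewrite /Log modulus_realC normr1 ln1 /= mul0r atan0.
Qed.

Lemma local_logD v v' y b x : local_log (v + v') y b x = local_log v y b x + v'.
Proof. by rewrite /local_log addrAC. Qed.

End Logarithms.

(** * Path integrals and residues *)

Section PathIntegrals.
Variable R : realType.
Local Notation C := (Cx R).
Local Notation Re := (@complex.Re R).
Local Notation Im := (@complex.Im R).
Implicit Types (f G : C -> C) (z w x a b c : C) (t r : R).

Lemma Rintegral01_derive (h H : R -> R) :
  (forall t, 0 <= t <= 1 -> is_derive t 1 H (h t)) ->
  (forall t, 0 <= t <= 1 -> h u @[u --> t] --> h t) ->
  \int[lebesgue_measure]_(t in `[0, 1]) h t = H 1 - H 0.
Proof.
move=> dH ch.
have cH t : 0 <= t <= 1 -> H u @[u --> t] --> H t.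
  by move=> /dH[dHt _]; exact/differentiable_continuous/derivable1_diffP.
rewrite /Rintegral (@continuous_FTC2 R h H 0 1) ?ltr01 //.
- apply: continuous_in_subspaceT => t; rewrite inE/= in_itv/=; exact: ch.
- split.
  + by move=> t; rewrite in_itv/= => /andP[? ?]; have [] := dH t; rewrite ?ltW.
  + by apply: cvg_at_right_filter; apply: cH; rewrite lexx ler01.
  + by apply: cvg_at_left_filter; apply: cH; rewrite lexx ler01.
- move=> t; rewrite in_itv/= => /andP[? ?]; rewrite derive1E.
  by have [] := dH t; rewrite ?ltW.
Qed.

(** [H] is a primitive along the curve and need not be a function of the point [p t]; this leaves
    room for closed curves with nonzero integral. *)
Lemma path_integral_derive f (p v H : R -> C) :
  (forall t, 0 <= t <= 1 -> curve_deriv p t (v t)) ->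
  (forall t, 0 <= t <= 1 -> curve_deriv H t (f (p t) * v t)) ->
  (forall t, 0 <= t <= 1 -> f (p u) * v u @[u --> t] --> f (p t) * v t) ->
  path_integral f p = H 1 - H 0.
Proof.
move=> dp dH cf; rewrite /path_integral /cintegral01.
have E (g : C -> R) : \int[lebesgue_measure]_(t in `[0, 1]) g (f (p t) * velocity p t) =
    \int[lebesgue_measure]_(t in `[0, 1]) g (f (p t) * v t).
  apply: eq_Rintegral => t; rewrite inE/= in_itv/= => t01.
  by rewrite (velocityE (dp _ t01)).
rewrite !E; apply/complex_eqP => /=; rewrite ReB ImB; split.
  apply: (@Rintegral01_derive _ (fun u => Re (H u))) => t t01.
    exact: (dH t t01).1.
  exact: (cvg_Re (cf t t01)).
apply: (@Rintegral01_derive _ (fun u => Im (H u))) => t t01.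
  exact: (dH t t01).2.
exact: (cvg_Im (cf t t01)).
Qed.

Lemma path_integral_segment f G x y :
  (forall t, 0 <= t <= 1 -> is_derive (segment x y t) 1 G (f (segment x y t))) ->
  (forall t, 0 <= t <= 1 -> f w @[w --> segment x y t] --> f (segment x y t)) ->
  path_integral f (segment x y) = G y - G x.
Proof.
move=> dG cf.
have ds t : curve_deriv (segment x y) t (y - x) by exact: curve_deriv_affine.
rewrite (@path_integral_derive f _ (fun=> y - x) (fun t => G (segment x y t))).
- by rewrite /segment mul1r mul0r addr0 [x + _]addrC subrK.
- by move=> t _.
- by move=> t /dG dGt; exact: curve_deriv_comp dGt (ds t).
- move=> t /cf cft; have c := cvg_comp _ _ (curve_deriv_cvg (ds t)) cft.
  exact: (@cvgM _ _ _ (nbhs_filter t) _ _ _ _ c (@cvg_cst _ (y - x) _ (nbhs t) _)).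
Qed.

Lemma curve_deriv_circle a r t :
  curve_deriv (circle a r) t (2 * picx * ii * (circle a r t - a)).
Proof.
pose k : C := 2 * picx * ii.
have -> : circle a r = fun u => a + r%:C * cexp (u%:C * k).
  by apply/funext => u; rewrite /circle [_ * u%:C]mulrC.
have := curve_derivD (curve_deriv_cst a t) (curve_derivM (curve_deriv_cst (r%:C) t)
  (curve_deriv_cexp k t)).
suff -> : 0 + (0 * cexp (t%:C * k) + r%:C * (k * cexp (t%:C * k))) =
  k * (a + r%:C * cexp (t%:C * k) - a) by [].
by ring.
Qed.

Lemma circle_dist a r t : `|circle a r t - a| = `|r|%:C.
Proof.
rewrite /circle addrAC subrr add0r modulusE modulusM modulus_realC modulus_cexp.
by rewrite two_pi_iiE /= expR0 mulr1.
Qed.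

(** Along the circle the velocity is 2 pi i (x - a), so c / (x - a) contributes the constant 2 pi i
    c. A primitive along the curve is therefore [G] plus t times this constant, and only the latter
    term has an increment. *)
Lemma path_integral_circle f G a c r : r != 0 ->
  (forall x, `|x - a| = `|r|%:C -> is_derive x 1 G (f x - c / (x - a))) ->
  (forall x, `|x - a| = `|r|%:C -> f w @[w --> x] --> f x) ->
  path_integral f (circle a r) = 2 * picx * ii * c.
Proof.
move=> r0 dG cf; pose k : C := 2 * picx * ii.
have dc t := curve_deriv_circle a r t.
have ca t : circle a r t - a != 0.
  by rewrite -normr_eq0 circle_dist fmorph_eq0 normr_eq0.
rewrite (@path_integral_derive f _ (fun t => k * (circle a r t - a))
  (fun t => G (circle a r t) + t%:C * (k * c))).
- rewrite /circle mul1r mul0r addr0 mulr1 mulr0 cexp_2pii cexp0.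
  by rewrite addrAC subrr add0r.
- by move=> t _.
- move=> t _; have H := curve_derivD (curve_deriv_comp (dG _ (circle_dist a r t)) (dc t))
    (curve_derivM (curve_deriv_real t) (curve_deriv_cst (k * c) t)).
  suff -> : f (circle a r t) * (k * (circle a r t - a)) =
     (f (circle a r t) - c / (circle a r t - a)) * (2 * picx * ii * (circle a r t - a)) +
     (1 * (k * c) + t%:C * 0) by [].
  by rewrite -/k; field.
- move=> t _; have cc := curve_deriv_cvg (dc t).
  have FF : Filter (nbhs t) by exact: nbhs_filter.
  have c1 := cvg_comp _ _ cc (cf _ (circle_dist a r t)).
  have c2 := @cvgB _ _ _ _ FF _ _ _ _ cc (@cvg_cst _ a _ _ FF).
  have c3 := @cvgM _ _ _ FF _ _ _ _ (@cvg_cst _ k _ _ FF) c2.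
  exact: (@cvgM _ _ _ FF _ _ _ _ c1 c3).
Qed.

(** For every radius below [d] the circle integral has the same value, so the limit is that of an
    eventually constant function. *)
Lemma Res_primitive f G a c (d : R) : 0 < d ->
  (forall x, x != a -> `|x - a| < d%:C -> is_derive x 1 G (f x - c / (x - a))) ->
  (forall x, x != a -> `|x - a| < d%:C -> f w @[w --> x] --> f x) ->
  Res f a = c.
Proof.
move=> d0 dG cf; rewrite /Res; apply: lim_near_cst; first exact: norm_hausdorff.
have k0 : (2 * picx * ii : C) != 0.
  by rewrite -[X in X != _]mulr1 (two_pi_iiE 1) mulr1 eq_complex /= eqxx /=
     -mulr_natl mulf_neq0// gt_eqF// pi_gt0.
near=> r.
have r0 : 0 < r by near: r; exact: nbhs_right_gt.
have rd : r < d by near: r; exact: nbhs_right_lt.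
have xa x : `|x - a| = `|r|%:C -> x != a /\ `|x - a| < d%:C.
  rewrite (gtr0_norm r0) => e; split; last by rewrite e ltcR.
  by rewrite -subr_eq0 -normr_eq0 e fmorph_eq0 gt_eqF.
have -> : path_integral f (circle a r) = 2 * picx * ii * c.
  apply: (@path_integral_circle f G); first by rewrite gt_eqF.
    by move=> x /xa[]; exact: dG.
  by move=> x /xa[]; exact: cf.
by rewrite mulKf.
Unshelve. all: by end_near. Qed.

End PathIntegrals.

(** * Primitives of rational functions *)

Section PartialFractions.
Variable R : realType.
Local Notation C := (Cx R).
Variable S : seq C.
Implicit Types (f g : C -> C) (x a b : C) (P : {poly C}).

Definition simple_part (c : C -> C) x : C := \sum_(b <- S) c b * (x - b)^-1.

(** The coefficients are left existential: the class is then closed under linear combinations, and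
    [Res_pole] recovers them as residues of [f]. *)
Definition primitive_mod_poles f : Prop :=
  exists Q c : C -> C, forall x, x \notin S ->
    is_derive x 1 Q (f x - simple_part c x).

Lemma primitive_ext f g : (forall x, x \notin S -> f x = g x) ->
  primitive_mod_poles f -> primitive_mod_poles g.
Proof. by move=> fg [Q [c H]]; exists Q, c => x xS; rewrite -fg// ; exact: H. Qed.

Lemma primitiveD f g : primitive_mod_poles f -> primitive_mod_poles g ->
  primitive_mod_poles (fun x => f x + g x).
Proof.
move=> [Q [c H]] [Q' [c' H']]; exists (fun x => Q x + Q' x), (fun b => c b + c' b).
move=> x xS; have -> : f x + g x - simple_part (fun b => c b + c' b) x =
    (f x - simple_part c x) + (g x - simple_part c' x).
  rewrite /simple_part; under eq_bigr do rewrite mulrDl.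
  by rewrite big_split /=; ring.
exact: (@is_deriveD _ _ _ Q Q' x 1 _ _ (H x xS) (H' x xS)).
Qed.

Lemma primitiveZ k f : primitive_mod_poles f -> primitive_mod_poles (fun x => k * f x).
Proof.
move=> [Q [c H]]; exists (fun x => k * Q x), (fun b => k * c b).
move=> x xS; have -> : k * f x - simple_part (fun b => k * c b) x =
    k * (f x - simple_part c x).
  rewrite /simple_part; under eq_bigr do rewrite -mulrA.
  by rewrite -mulr_sumr; ring.
exact: (@is_deriveZ _ _ _ Q k x 1 _ (H x xS)).
Qed.

Lemma primitive_of_derive f Q : (forall x, x \notin S -> is_derive x 1 Q (f x)) ->
  primitive_mod_poles f.
Proof.
move=> H; exists Q, (fun=> 0) => x xS; rewrite /simple_part.
by rewrite big1 ?subr0; [exact: H|move=> b _; rewrite mul0r].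
Qed.

Lemma is_derive_powC (f : C -> C) n x df : is_derive x 1 f df ->
  is_derive x 1 (fun w => f w ^+ n.+1) (n.+1%:R * f x ^+ n * df).
Proof.
by move=> H; have := @is_deriveX _ _ f n.+1 x 1 df H; rewrite exprfctE.
Qed.

Lemma is_derive_subC a x : is_derive x 1 (fun w : C => w - a) 1.
Proof.
have := @is_deriveB _ _ _ id (cst a) x 1 1 0 (is_derive_id x 1) (is_derive_cst a x 1).
by rewrite subr0.
Qed.

Lemma is_derive_invC x : x != 0 -> is_derive x 1 (fun w : C => w^-1) (- (x ^+ 2)^-1).
Proof.
move=> x0; have -> : - (x ^+ 2)^-1 = x^-1 * - x^-1 by rewrite expr2 invfM mulrN.
apply: (@Caratheodory_is_derive _ _ (fun w => w^-1 * - x^-1)).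
  exact: cvgC_M (cvgC_V x0 (@cvgC_id _ x)) (@cvgC_cst _ x _).
have m0 : 0 < modulus x by rewrite -ltcR -modulusE normr_gt0.
apply/nearCP; exists (modulus x) => // w; rewrite -modulusE => wx.
have w0 : w != 0 by apply: contraTneq wx => ->; rewrite sub0r normrN ltxx.
by field; rewrite x0 w0.
Qed.

Lemma primitive_pow n : primitive_mod_poles (fun x => x ^+ n).
Proof.
apply: (@primitive_of_derive _ (fun x => (n.+1%:R)^-1 * x ^+ n.+1)) => x _.
have := @is_deriveZ _ _ _ _ (n.+1%:R)^-1 x 1 _ (is_derive_powC n (is_derive_id x 1)).
by rewrite /GRing.scale /= mulr1 mulKf// pnatr_eq0.
Qed.

Lemma primitive_poly P : primitive_mod_poles (fun x => P.[x]).
Proof.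
have -> : (fun x => P.[x]) = (fun x => \sum_(i < size P) P`_i * x ^+ i).
  by apply/funext => x; rewrite horner_coef.
elim: (size P) => [|n IH].
  apply: (@primitive_of_derive _ (fun=> 0)) => x _.
  by rewrite big_ord0; exact: is_derive_cst.
apply: primitive_ext (primitiveD IH (primitiveZ P`_n (primitive_pow n))).
by move=> x _; rewrite big_ord_recr.
Qed.

Hypothesis S_uniq : uniq S.

Lemma primitive_pole_pow a n : a \in S -> primitive_mod_poles (fun x => (x - a)^-1 ^+ n.+1).
Proof.
move=> aS; case: n => [|n].
  (* The simple pole is the only power without a primitive; it goes entirely into the
     coefficients. *)
  exists (fun=> 0), (fun b => (b == a)%:R) => x _.
  have -> : simple_part (fun b => (b == a)%:R) x = (x - a)^-1.
    rewrite /simple_part (bigD1_seq a)//= eqxx mul1r big1 ?addr0// => b /negPf ->.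
    by rewrite mul0r.
  by rewrite expr1 subrr; exact: is_derive_cst.
apply: (@primitive_of_derive _ (fun x => - (n.+1%:R)^-1 * (x - a)^-1 ^+ n.+1)) => x xS.
have xa : x - a != 0 by rewrite subr_eq0; apply: contraNneq xS => ->.
have D1 := @is_derive_compC _ (fun w => w^-1) (fun w => w - a) x _ _
  (is_derive_invC xa) (is_derive_subC a x).
have := @is_deriveZ _ _ _ _ (- (n.+1%:R)^-1) x 1 _ (is_derive_powC n D1).
rewrite /GRing.scale /=.
suff -> : - n.+1%:R^-1 * (n.+1%:R * (x - a)^-1 ^+ n * (- ((x - a) ^+ 2)^-1 * 1)) =
  (x - a)^-1 ^+ n.+2 by [].
by rewrite mulr1 mulrN !mulNr mulrN opprK mulrA mulKf ?pnatr_eq0// -exprVn -exprD addn2.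
Qed.

(** Writing P = q (X - a) + P(a) lowers the order of the pole by one, up to a pure power. *)
Lemma primitive_one_pole P a n : a \in S ->
  primitive_mod_poles (fun x => P.[x] * (x - a)^-1 ^+ n).
Proof.
move=> aS; elim: n P => [|n IH] P.
  by apply: primitive_ext (primitive_poly P) => x _; rewrite expr0 mulr1.
have /factor_theorem[q Pq] : root (P - P.[a]%:P) a.
  by rewrite /root hornerD hornerN hornerC subrr.
apply: primitive_ext (primitiveD (IH q) (primitiveZ P.[a] (primitive_pole_pow n aS))).
move=> x xS; have xa : x - a != 0 by rewrite subr_eq0; apply: contraNneq xS => ->.
have -> : P.[x] = q.[x] * (x - a) + P.[a].
  rewrite -[in LHS](subrK P.[a]%:P P) Pq hornerD hornerM hornerXsubC.
  by rewrite hornerC.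
by rewrite mulrDl exprS -!mulrA mulVKf.
Qed.

(** The identity 1/((x - a)(x - b)) = (1/(x - a) - 1/(x - b)) / (a - b) lowers one of the two orders
    in each term, whence the nested induction. *)
Lemma primitive_two_poles P a b n m : a \in S -> b \in S -> a != b ->
  primitive_mod_poles (fun x => P.[x] * (x - a)^-1 ^+ n * (x - b)^-1 ^+ m).
Proof.
move=> aS bS ab; elim: n m => [|n IHn] m.
  by apply: primitive_ext (primitive_one_pole P m bS) => x _; rewrite expr0 mulr1.
elim: m => [|m IHm].
  by apply: primitive_ext (primitive_one_pole P n.+1 aS) => x _; rewrite expr0 mulr1.
apply: primitive_ext (primitiveZ (a - b)^-1 (primitiveD IHm (primitiveZ (-1) (IHn m.+1)))).
move=> x xS; have xa : x - a != 0 by rewrite subr_eq0; apply: contraNneq xS => ->.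
have xb : x - b != 0 by rewrite subr_eq0; apply: contraNneq xS => ->.
rewrite !exprS; set u := _ ^+ n; set v := _ ^+ m; set p := P.[x].
by field; rewrite xa xb subr_eq0 ab.
Qed.

End PartialFractions.

(** * Rules of differentiation, distance to the poles, residues as coefficients of simple poles *)

Section DerivativeRules.
Variable R : realType.
Local Notation C := (Cx R).
Implicit Types (f g : C -> C) (x a b : C).

Lemma is_derive_addC f g x df dg : is_derive x 1 f df -> is_derive x 1 g dg ->
  is_derive x 1 (fun w => f w + g w) (df + dg).
Proof. by move=> Hf Hg; exact: (@is_deriveD _ _ _ f g x 1 _ _ Hf Hg). Qed.

Lemma is_derive_mulC f g x df dg : is_derive x 1 f df -> is_derive x 1 g dg ->
  is_derive x 1 (fun w => f w * g w) (df * g x + f x * dg).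
Proof.
move=> Hf Hg; have := @is_deriveM _ _ f g x 1 _ _ Hf Hg.
by rewrite /GRing.scale /= addrC [g x * df]mulrC.
Qed.

Lemma is_derive_scaleC k f x df : is_derive x 1 f df ->
  is_derive x 1 (fun w => k * f w) (k * df).
Proof. by move=> Hf; exact: (@is_deriveZ _ _ _ f k x 1 _ Hf). Qed.

Lemma is_derive_linear_comb (S : seq C) (k : C -> C) (L : C -> C -> C) x :
  (forall b, b \in S -> is_derive x 1 (L b) (x - b)^-1) ->
  is_derive x 1 (fun w => \sum_(b <- S) k b * L b w) (simple_part S k x).
Proof.
rewrite /simple_part; elim: S => [|b S IH] H.
  under eq_fun do rewrite big_nil.
  by rewrite big_nil; exact: is_derive_cst.
under eq_fun do rewrite big_cons.
rewrite big_cons; apply: is_derive_addC.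
  by apply: is_derive_scaleC; apply: H; rewrite mem_head.
by apply: IH => b' b'S; apply: H; rewrite inE b'S orbT.
Qed.

Lemma is_derive_cexp_comp f x df : is_derive x 1 f df ->
  is_derive x 1 (fun w => cexp (f w)) (cexp (f x) * df).
Proof. by move=> Hf; exact: is_derive_compC (is_derive_cexp _) Hf. Qed.

Lemma derivable_mx2 (f g h k : C -> C) x :
  derivable f x 1 -> derivable g x 1 -> derivable h x 1 -> derivable k x 1 ->
  derivable (fun w => mx2 (f w) (g w) (h w) (k w)) x 1.
Proof.
move=> df dg dh dk.
have -> : (fun w => mx2 (f w) (g w) (h w) (k w)) =
    (fun w => f w *: delta_mx 0 0) + (fun w => g w *: delta_mx 0 1) +
    (fun w => h w *: delta_mx 1 0) + (fun w => k w *: delta_mx 1 1).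
  by apply/funext => w; rewrite mx2E.
have D (u : C -> C) (A : 'M[C]_2) : derivable u x 1 -> derivable (fun w => u w *: A) x 1.
  move=> /derivable1_diffP du; apply/derivable1_diffP; exact: differentiableZl.
exact: derivableD (derivableD (derivableD (D _ _ df) (D _ _ dg)) (D _ _ dh)) (D _ _ dk).
Qed.

Lemma dist_to_poles (S : seq C) x : x \notin S ->
  exists2 r : R, 0 < r & forall b, b \in S -> r%:C <= `|x - b|.
Proof.
elim: S => [|b S IH] /=; first by exists 1.
rewrite inE negb_or => /andP[xb /IH[r r0 H]].
have m0 : 0 < modulus (x - b) by rewrite -ltcR -modulusE normr_gt0 subr_eq0.
exists (Num.min r (modulus (x - b))); first by rewrite lt_min r0.
move=> c; rewrite inE => /orP[/eqP->|/H]; rewrite modulusE !lecR ge_min.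
  by rewrite lexx orbT.
by move=> ->.
Qed.

Lemma near_notin_poles (S : seq C) x : x \notin S -> \forall w \near x, w \notin S.
Proof.
move=> /dist_to_poles[r r0 H]; apply/nearCP; exists r => // w wx.
by apply/negP => /H; rewrite distrC => /(lt_le_trans wx); rewrite ltxx.
Qed.

Lemma Res_pole (S : seq C) f (Q c : C -> C) a : uniq S -> a \in S ->
  (forall x, x \notin S -> is_derive x 1 Q (f x - simple_part S c x)) ->
  (forall x, x \notin S -> f w @[w --> x] --> f x) ->
  Res f a = c a.
Proof.
move=> uS aS dQ cf.
have aS' : a \notin rem a S by rewrite mem_rem_uniq// inE eqxx.
have [r r0 Hr] := dist_to_poles aS'.
have xS x : x != a -> `|x - a| < r%:C -> x \notin S.
  move=> xa xr; apply/negP => xinS.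
  have /Hr : x \in rem a S by rewrite mem_rem_uniq// inE xa.
  by rewrite distrC => /(lt_le_trans xr); rewrite ltxx.
(* Near [a] the logarithms at the other poles are analytic and join the primitive, which leaves only
   the term of [a]. Their value 0 at [a] is an arbitrary choice. *)
apply: (@Res_primitive _ f
  (fun x => Q x + \sum_(b <- rem a S) c b * local_log 0 a b x) a (c a) r r0).
- move=> x xa xr.
  have -> : f x - c a / (x - a) =
      f x - simple_part S c x + simple_part (rem a S) c x.
    rewrite /simple_part (perm_big _ (perm_to_rem aS)) big_cons /=.
    by rewrite opprD addrA subrK.
  apply: is_derive_addC; first exact/dQ/xS.
  apply: (@is_derive_linear_comb _ c (fun b x => local_log 0 a b x)) => b /Hr rb.
  by apply: is_derive_local_log; exact: lt_le_trans xr rb.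
- by move=> x xa xr; apply: cf; exact: xS.
Qed.

End DerivativeRules.

(** * Analytic continuation *)

Lemma near_in_seq (T : eqType) (s : seq T) {U : Type} (F : set_system U) {FF : Filter F}
    (P : T -> U -> Prop) :
  (forall i, i \in s -> \forall u \near F, P i u) ->
  \forall u \near F, forall i, i \in s -> P i u.
Proof.
elim: s => [|i s IH] H; first by apply: filterS filterT.
have H1 := H i (mem_head _ _).
have H2 : \forall u \near F, forall j, j \in s -> P j u.
  by apply: IH => j js; apply: H; rewrite inE js orbT.
apply: filterS2 H1 H2 => u Pi Ps j; rewrite inE => /orP[/eqP->//|]; exact: Ps.
Qed.

Section Continuation.
Variable R : realType.
Local Notation C := (Cx R).
Local Notation Im := (@complex.Im R).
Variables (S : seq C) (k1 k2 c Q : C -> C).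
Implicit Types (x a b : C) (t u : R) (L : C -> C).

Definition comb (k L : C -> C) : C := \sum_(b <- S) k b * L b.

(** The fundamental matrix as a function of the values [L b] of the logarithms of x - b and of the
    single-valued part [q] of the integral: all multivaluedness sits in [L]. *)
Definition triangular_mx L (q : C) : 'M[C]_2 :=
  mx2 (cexp (comb k1 L)) (cexp (comb k1 L) * (q + comb c L)) 0 (cexp (comb k2 L)).

Lemma eq_comb k L L' : {in S, L =1 L'} -> comb k L = comb k L'.
Proof. by move=> LL'; apply: eq_big_seq => b /LL' ->. Qed.

Lemma eq_triangular_mx L L' q : {in S, L =1 L'} -> triangular_mx L q = triangular_mx L' q.
Proof. by move=> LL'; rewrite /triangular_mx !(eq_comb _ LL'). Qed.

Hypothesis dQ : forall x, x \notin S -> derivable Q x 1.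

Lemma derivable_triangular_mx (L : C -> C -> C) (q : C) x : x \notin S ->
  (forall b, b \in S -> is_derive x 1 (L b) (x - b)^-1) ->
  derivable (fun w => triangular_mx (L ^~ w) (q + Q w)) x 1.
Proof.
move=> xS dL.
have dl k : is_derive x 1 (fun w => comb k (L ^~ w)) (simple_part S k x).
  exact: (@is_derive_linear_comb _ S k L x dL).
have de k := is_derive_cexp_comp (dl k).
have dq := is_derive_addC (is_derive_cst q x 1) (derivableP (dQ xS)).
apply: derivable_mx2.
- by have [] := de k1.
- by have [] := is_derive_mulC (de k1) (is_derive_addC dq (dl c)).
- exact: derivable_cst.
- by have [] := de k2.
Qed.

Variables (br : C -> C -> C) (sg : C -> C) (x0 q : C).
Hypothesis sg_neq0 : forall b, sg b != 0.
Hypothesis cexp_br : forall b x, b \in S -> x \notin S -> cexp (br b x) = sg b * (x - b).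
Hypothesis br_cont : forall b, b \in S -> br b w @[w --> x0] --> br b x0.

Lemma continues_along_path (p : R -> C) (n : C -> int) :
  {within `[0, 1], continuous p} -> p 0 = x0 -> p 1 = x0 ->
  (forall t, t \in `[0, 1] -> p t \notin S) ->
  (forall b, b \in S -> winding p b (n b)) ->
  continues_to p (fun x => triangular_mx (br ^~ x) (q + Q x))
    (fun x => triangular_mx (fun b => br b x + 2 * picx * ii * (n b)%:~R) (q + Q x)).
Proof.
move=> cp p0 p1 pS wp.
have i0 : (0 : R) \in `[0, 1] by rewrite in_itv/= lexx ler01.
have i1 : (1 : R) \in `[0, 1] by rewrite in_itv/= lexx ler01.
have x0S : x0 \notin S by rewrite -p0 pS.
have [th Hth] : exists th : C -> R -> C, forall b, b \in S ->
    [/\ {within `[0, 1], continuous (th b)},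
        forall t, t \in `[0, 1] -> cexp (th b t) = p t - b
      & th b 1 - th b 0 = 2 * picx * ii * (n b)%:~R].
  have : forall b : C, exists th : R -> C, b \in S ->
    [/\ {within `[0, 1], continuous th},
        forall t, t \in `[0, 1] -> cexp (th t) = p t - b
      & th 1 - th 0 = 2 * picx * ii * (n b)%:~R].
    move=> b; have [bS|_] := boolP (b \in S); last by exists (fun=> 0).
    by have [th H] := wp b bS; exists th.
  by move=> /choice[th H]; exists th.
(* The continuous logarithm of p - b is shifted so as to start from the given branch at [x0]. *)
pose v b t := br b x0 + th b t - th b 0.
have ev b t : b \in S -> t \in `[0, 1] -> cexp (v b t) = sg b * (p t - b).
  move=> bS t01; have [_ eth _] := Hth b bS.
  rewrite /v cexpB cexpD cexp_br// !eth// p0 -mulrA mulrAC mulrC.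
  have x0b : x0 - b != 0 by rewrite subr_eq0; apply: contraNneq x0S => ->.
  by field.
pose F t x := triangular_mx (fun b => local_log (v b t) (p t) b x) (q + Q x).
have cth b t : b \in S -> t \in `[0, 1] ->
    th b u @[u --> within `[0, 1] (nbhs t)] --> th b t.
  move=> bS t01; have [/subspace_continuousP H _ _] := Hth b bS.
  exact: H.
have cpt t : t \in `[0, 1] -> p u @[u --> within `[0, 1] (nbhs t)] --> p t.
  by move=> t01; move/subspace_continuousP : cp => H; exact: H.
have near_br : \forall x \near x0, forall b, b \in S -> local_log (br b x0) x0 b x = br b x.
  have [r r0 Hr] := dist_to_poles x0S.
  have FF : Filter (nbhs x0) by exact: nbhs_filter.
  have N : \forall x \near nbhs x0, forall b, b \in S -> `|br b x - br b x0| < pi%:C.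
    apply: near_in_seq => b bS.
    exact: (@cvgCdistP _ _ _ FF _ _).1 (br_cont bS) _ (pi_gt0 R).
  move/nearCP : N => [d d0 Hd].
  apply/nearCP; exists (Num.min r d); first by rewrite lt_min r0.
  move=> x; rewrite modulusE ltcR lt_min => /andP[xr xd] b bS.
  have xr' : `|x - x0| < r%:C by rewrite modulusE ltcR.
  have xS : x \notin S.
    by apply/negP => /Hr; rewrite distrC => /(lt_le_trans xr'); rewrite ltxx.
  have xb : x != b by apply: contraNneq xS => ->.
  (* The branch value at [x] is that of a local logarithm centred at [x], so two local logarithms
     are compared; continuity of the branch at [x0] provides the bound pi. *)
  rewrite -[RHS](@local_log_center _ _ b x xb).
  apply: (@local_log_inj _ _ _ _ _ _ (sg b)) => //.
  - exact: lt_le_trans xr' (Hr b bS).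
  - by rewrite subrr normr0 normr_gt0 subr_eq0.
  - exact: cexp_br.
  - exact: cexp_br.
  - rewrite -ltcR (le_lt_trans (normC_Im _))// distrC; apply: Hd => //.
    by rewrite modulusE ltcR.
exists F; split.
- move=> t t01; have [r r0 Hr] := dist_to_poles (pS t t01); split.
    apply/nearCP; exists r => // x xt; apply: derivable_triangular_mx.
      apply/negP => /Hr; rewrite distrC => /(lt_le_trans xt).
      by rewrite ltxx.
    move=> b bS; apply: is_derive_local_log; exact: lt_le_trans xt (Hr b bS).
  (* If [p u] is within r/2 of [p t] and [x] within r/2 of [p u], then [x] lies in the disc of
     radius [r] around [p t], where the germ at time [t] is defined. *)
  have r20 : 0 < r / 2 by rewrite divr_gt0.
  have FF : Filter (within `[0, 1] (nbhs t)) by exact: within_filter.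
  have N1 : \forall u \near within `[0, 1] (nbhs t), `|p u - p t| < (r / 2)%:C.
    exact: (@cvgCdistP _ _ _ FF _ _).1 (cpt t t01) _ r20.
  have N2 : \forall u \near within `[0, 1] (nbhs t),
      forall b, b \in S -> `|th b u - th b t| < pi%:C.
    apply: near_in_seq => b bS.
    exact: (@cvgCdistP _ _ _ FF _ _).1 (cth b t bS t01) _ (pi_gt0 R).
  have N3 : \forall u \near nbhs t, u \in `[0, 1] -> `|p u - p t| < (r / 2)%:C /\
      forall b, b \in S -> `|th b u - th b t| < pi%:C.
    by have : \forall u \near within `[0, 1] (nbhs t), `|p u - p t| < (r / 2)%:C /\
      forall b, b \in S -> `|th b u - th b t| < pi%:C by exact: filterS2 N1 N2.
  apply: filterS N3 => u Hu u01; have [pu thu] := Hu u01.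
  have [r' r'0 Hr'] := dist_to_poles (pS u u01).
  apply/nearCP; exists (Num.min (r / 2) r'); first by rewrite lt_min r20.
  move=> x; rewrite modulusE ltcR lt_min => /andP[xu xu'].
  apply: eq_triangular_mx => b bS; apply: (@local_log_inj _ _ _ _ _ _ (sg b)) => //.
  + by apply: lt_le_trans (Hr' b bS); rewrite modulusE ltcR.
  + apply: lt_le_trans (Hr b bS); rewrite -(subrK (p u) x) -addrA.
    apply: le_lt_trans (ler_normD _ _) _; move: pu.
    by rewrite !modulusE -rmorphD !ltcR => pu; rewrite [r]splitr ltrD.
  + exact: ev.
  + exact: ev.
  + have -> : v b u - v b t = th b u - th b t by rewrite /v; ring.
    by rewrite -ltcR (le_lt_trans (normC_Im _))// thu.
- rewrite p0; apply: filterS near_br => x Hx.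
  apply: eq_triangular_mx => b bS; rewrite p0 -(Hx b bS).
  by rewrite /v addrK.
- rewrite p1; apply: filterS near_br => x Hx.
  apply: eq_triangular_mx => b bS; rewrite p1 -(Hx b bS) -local_logD.
  by have [_ _ <-] := Hth b bS; rewrite /v addrA.
Qed.

End Continuation.

(** * The Heun type equation at resonance *)

Section Resonance.
Variable R : realType.
Local Notation C := (Cx R).
Implicit Types (x b k v : C).

Definition is_intC k := exists n : nat, k = n%:R \/ k = - n%:R.

(** Jumps of a branch by multiples of 2 pi i are invisible to integer exponents. *)
Lemma cexp_int k v v' : is_intC k -> cexp v = cexp v' -> cexp (k * v) = cexp (k * v').
Proof. by case=> n [] -> vv'; rewrite ?mulNr ?cexpN !cexp_natM vv'. Qed.

Lemma cexp_comb_int (S : seq C) (k L L' : C -> C) :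
  (forall b, b \in S -> is_intC (k b)) ->
  (forall b, b \in S -> cexp (L b) = cexp (L' b)) ->
  cexp (comb S k L) = cexp (comb S k L').
Proof.
rewrite /comb; elim: S => [|b S IH] kS LS; first by rewrite !big_nil.
rewrite !big_cons !cexpD; congr (_ * _).
  by apply: cexp_int; [apply: kS|apply: LS]; rewrite mem_head.
by apply: IH => b' b'S; [apply: kS|apply: LS]; rewrite inE b'S orbT.
Qed.

Lemma cvg_near_eq (f h : C -> C) x : (\forall w \near x, f w = h w) ->
  h w @[w --> x] --> h x -> f w @[w --> x] --> f x.
Proof.
move=> /nearCP[d d0 fh] ch; apply/(@cvgCdistP _ _ (nbhs x)) => r r0.
have [e e0 He] := (nearCP _ _).1 ((@cvgCdistP _ _ (nbhs x) _ _ _).1 ch _ r0).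
apply/nearCP; exists (Num.min d e); first by rewrite lt_min d0.
move=> w; rewrite modulusE ltcR lt_min => /andP[wd we].
have -> : f w = h w by apply: fh; rewrite modulusE ltcR.
have -> : f x = h x by apply: fh; rewrite subrr normr0 ltcR.
by apply: He; rewrite modulusE ltcR.
Qed.

Variables (eps : R) (eps_gt0 : 0 < eps) (eps_lt1 : eps < 1).
Local Notation s := (se eps).
Local Notation S := (sing eps).

Lemma se_neq0 : s != 0.
Proof. by rewrite fmorph_eq0 sqrtr_eq0 -ltNge. Qed.

Lemma se_sqr : s ^+ 2 = eps%:C.
Proof. by rewrite -rmorphXn /= sqr_sqrtr// ltW. Qed.

Let s_neqN : s != - s.
Proof. by rewrite -subr_eq0 opprK -mulr2n -mulr_natl mulf_neq0 ?se_neq0// pnatr_eq0. Qed.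

Let s_neqV : s != s^-1.
Proof.
apply/eqP => /(congr1 (fun x => s * x)); rewrite -expr2 se_sqr divff ?se_neq0//.
by move=> /(@complexI R) e; move: eps_lt1; rewrite e ltxx.
Qed.

Let s_neqNV : s != - s^-1.
Proof.
apply/eqP => /(congr1 (fun x => s * x)); rewrite -expr2 se_sqr mulrN divff ?se_neq0//.
move=> /complex_eqP[/= e _]; move: eps_gt0; rewrite e.
by rewrite oppr_gt0 ltNge ler01.
Qed.

Let V_neqNV : s^-1 != - s^-1.
Proof.
by rewrite -subr_eq0 opprK -mulr2n -mulr_natl mulf_neq0 ?invr_neq0 ?se_neq0.
Qed.

(** A coincidence s = 1/s would mean eps = 1, and s = -1/s would mean eps = -1. *)
Lemma sing_uniq : uniq S.
Proof.
rewrite /sing /= !inE !negb_or s_neqN s_neqV s_neqNV V_neqNV.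
by rewrite eqr_oppLR s_neqNV eqr_opp s_neqV.
Qed.

(** A family indexed by the four singular points, as a function on the whole plane so that it fits
    sums over [S]; other points get the last value. *)
Definition at_sing (vR vL vRR vLL b : C) : C :=
  if b == s then vR else if b == - s then vL else if b == s^-1 then vRR else vLL.

Section at_sing.
Variables vR vL vRR vLL : C.
Local Notation f := (at_sing vR vL vRR vLL).

Lemma at_singR : f s = vR.
Proof. by rewrite /at_sing eqxx. Qed.

Lemma at_singL : f (- s) = vL.
Proof. by rewrite /at_sing eq_sym (negPf s_neqN) eqxx. Qed.

Lemma at_singRR : f s^-1 = vRR.
Proof.
by rewrite /at_sing eq_sym (negPf s_neqV) -eqr_oppLR [- _ == _]eq_sym (negPf s_neqNV) eqxx.
Qed.

Lemma at_singLL : f (- s^-1) = vLL.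
Proof.
by rewrite /at_sing eq_sym (negPf s_neqNV) eqr_opp eq_sym (negPf s_neqV) eq_sym (negPf V_neqNV).
Qed.

End at_sing.

Definition at_singE := (at_singR, at_singL, at_singRR, at_singLL).

Lemma sum_sing (F : C -> C) : \sum_(b <- S) F b = F s + F (- s) + F s^-1 + F (- s^-1).
Proof. by rewrite /sing !big_cons big_nil addr0 !addrA. Qed.

Lemma in_singP (P : C -> Prop) : P s -> P (- s) -> P s^-1 -> P (- s^-1) ->
  forall b, b \in S -> P b.
Proof. by move=> p1 p2 p3 p4 b; rewrite !inE => /or4P[] /eqP ->. Qed.

Lemma nonsing_neq0 x : x \notin S ->
  [/\ x - s != 0, x + s != 0, x - s^-1 != 0 & x + s^-1 != 0].
Proof.
rewrite !inE !negb_or => /and4P[a b c d].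
by rewrite !subr_eq0 -[x + s]opprK -[x + s^-1]opprK !oppr_eq0 !addr_eq0 a b c d.
Qed.

(** * Exponents at the four singular points and rationality of the ratio *)

Variables (beta gamma : 'rV[C]_2) (beta_neq : beta 0 0 <> beta 0 1).
Variables (cs : resonance_case) (res : double_resonance eps beta gamma cs).
Variable (l : log_branches eps).
Local Notation beta1 := (beta 0 0).
Local Notation beta2 := (beta 0 1).
Local Notation gamma1 := (gamma 0 0).
Local Notation gamma2 := (gamma 0 1).

Definition branch b x := at_sing (logR l x) (logL l x) (logRR l x) (logLL l x) b.
(** The third factor is 1/s - x = - (x - 1/s). With this sign all four branches become logarithms of
    multiples of x - b, with derivative 1/(x - b). *)
Definition branch_sign b : C := at_sing 1 1 (-1) 1 b.
Definition expo1 b := at_sing (beta1 / (2 * s)) (- (beta1 / (2 * s)))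
  (- (gamma1 / (2 * s))) (gamma1 / (2 * s)) b.
Definition expo2 b := at_sing (beta2 / (2 * s) - 1) (- (beta2 / (2 * s) + 1))
  (- (gamma2 / (2 * s))) (gamma2 / (2 * s)) b.

Lemma branch_sign_neq0 b : branch_sign b != 0.
Proof. by rewrite /branch_sign /at_sing; do 3 ?case: ifP => // _; rewrite ?oppr_eq0 oner_eq0. Qed.

Lemma cexp_branch b x : b \in S -> x \notin S -> cexp (branch b x) = branch_sign b * (x - b).
Proof.
move=> + xS; move: b; apply: in_singP; rewrite /branch /branch_sign !at_singE.
- by rewrite logRP// mul1r.
- by rewrite logLP// mul1r opprK.
- by rewrite logRRP// mulN1r opprB.
- by rewrite logLLP// mul1r opprK addrC.
Qed.

Lemma Phi1E x : Phi1 beta gamma l x = cexp (comb S expo1 (branch ^~ x)).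
Proof.
rewrite /Phi1 -cexpD /comb sum_sing /expo1 /branch !at_singE.
by congr cexp; ring.
Qed.

Lemma Phi2E x : Phi2 beta gamma l x = cexp (comb S expo2 (branch ^~ x)).
Proof.
rewrite /Phi2 -cexpB -cexpD /comb sum_sing /expo2 /branch !at_singE.
by congr cexp; ring.
Qed.

Lemma ratioE x : ratio beta gamma l x =
  cexp (comb S (fun b => expo2 b - expo1 b) (branch ^~ x)).
Proof.
rewrite /ratio Phi1E Phi2E -cexpB /comb; congr cexp.
by rewrite -sumrB; apply: eq_bigr => b _; rewrite mulrBl.
Qed.

Let nu := (beta2 - beta1) / (2 * s).
Let mu := (gamma2 - gamma1) / (2 * s).

Lemma expo_diff b : expo2 b - expo1 b = at_sing (nu - 1) (- nu - 1) (- mu) mu b.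
Proof.
rewrite /expo1 /expo2 /at_sing /nu /mu; have s0 := se_neq0.
by case: (b == s); [|case: (b == - s); [|case: (b == s^-1)]]; field.
Qed.

(** Since [nu] is a nonzero integer, one of the exponents nu - 1 and - nu - 1 is a natural number,
    so only one of the points s, -s is a pole of the ratio. *)
Let nu_int : exists n : nat, nu = n.+1%:R \/ nu = - n.+1%:R.
Proof.
have nu0 : nu != 0.
  rewrite mulf_neq0 ?invr_neq0 ?mulf_neq0 ?se_neq0 ?pnatr_eq0//.
  by rewrite subr_eq0; apply/eqP => e; exact: beta_neq.
have H n : nu = n%:R \/ nu = - n%:R -> exists n : nat, nu = n.+1%:R \/ nu = - n.+1%:R.
  case: n => [|n] e; last by exists n.
  by move: nu0; case: e => ->; rewrite ?oppr0 eqxx.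
have opp : (beta1 - beta2) / (2 * s) = - nu by rewrite /nu -mulNr opprB.
case: cs res => -[[n e] _]; apply: (H n).
- by left.
- by left.
- by right; rewrite -e opp opprK.
- by right; rewrite -e opp opprK.
Qed.

Let mu_int : is_intC mu.
Proof.
have opp : (gamma1 - gamma2) / (2 * s) = - mu by rewrite /mu -mulNr opprB.
case: cs res => -[_ [n e]]; exists n.
- by right; rewrite -e opp opprK.
- by left.
- by right; rewrite -e opp opprK.
- by left.
Qed.

Lemma expo_diff_int b : b \in S -> is_intC (expo2 b - expo1 b).
Proof.
rewrite expo_diff; have [n nuE] := nu_int; have [m muE] := mu_int.
move: b; apply: in_singP; rewrite ?at_singE.
- case: nuE => ->; first by exists n; left; rewrite -natr1 addrK.
  by exists n.+2; right; rewrite -[n.+2%:R]natr1 opprD.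
- case: nuE => ->; first by exists n.+2; right; rewrite -[n.+2%:R]natr1 opprD.
  by exists n; left; rewrite opprK -natr1 addrK.
- by exists m; case: muE => ->; rewrite ?opprK; [right|left].
- by exists m.
Qed.

(** The branches may jump at [x]. As the exponents are integers, they can be replaced near [x] by
    local logarithms, which are continuous. *)
Lemma ratio_continuous x : x \notin S ->
  ratio beta gamma l w @[w --> x] --> ratio beta gamma l x.
Proof.
move=> xS; have [r r0 Hr] := dist_to_poles xS.
pose L b w := local_log (branch b x) x b w.
pose h w := cexp (comb S (fun b => expo2 b - expo1 b) (L ^~ w)).
have wS w : `|w - x| < r%:C -> w \notin S.
  by move=> wx; apply/negP => /Hr; rewrite distrC => /(lt_le_trans wx); rewrite ltxx.
apply: (@cvg_near_eq _ h); last first.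
  have dL b : b \in S -> is_derive x 1 (L b) (x - b)^-1.
    move=> bS; apply: is_derive_local_log; rewrite subrr normr0 normr_gt0 subr_eq0.
    by apply: contraNneq xS => ->.
  exact: is_derive_cvg (is_derive_cexp_comp (is_derive_linear_comb _ dL)).
apply/nearCP; exists r => // w wx; rewrite ratioE; apply: cexp_comb_int.
  exact: expo_diff_int.
move=> b bS; have xb : x - b != 0.
  by rewrite subr_eq0; apply: contraNneq xS => ->.
rewrite cexp_local_log; last exact: lt_le_trans wx (Hr b bS).
by rewrite (cexp_branch bS (wS w wx)) (cexp_branch bS xS); field.
Qed.

Lemma ratio_primitive : primitive_mod_poles S (ratio beta gamma l).
Proof.
have memS (b : C) : b \in [:: s; - s; s^-1; - s^-1] -> b \in S by [].
have [n nuE] := nu_int; have [m muE] := mu_int.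
(* For nu = n + 1 this factor is (x - s)^n / (x + s)^(n+2); for nu = - (n + 1) the roles of s and -s
   are exchanged. *)
have [a [aS [P1 [n1 H1]]]] : exists a : C, a \in [:: s; - s] /\ exists P n1,
    forall x, x \notin S -> cexp ((nu - 1) * logR l x + (- nu - 1) * logL l x) =
      P.[x] * (x - a)^-1 ^+ n1.
  case: nuE => ->.
  - exists (- s); split; first by rewrite !inE eqxx orbT.
    exists (('X - s%:P) ^+ n), n.+2 => x xS; rewrite horner_exp hornerXsubC opprK.
    have -> : n.+1%:R - 1 = n%:R :> C by rewrite -natr1 addrK.
    have -> : - n.+1%:R - 1 = - n.+2%:R :> C by rewrite -[n.+2%:R]natr1 opprD.
    by rewrite cexpD mulNr cexpN !cexp_natM logRP// logLP// exprVn.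
  - exists s; split; first by rewrite !inE eqxx.
    exists (('X + s%:P) ^+ n), n.+2 => x xS; rewrite horner_exp hornerD hornerX hornerC.
    have -> : - - n.+1%:R - 1 = n%:R :> C by rewrite opprK -natr1 addrK.
    have -> : - n.+1%:R - 1 = - n.+2%:R :> C by rewrite -[n.+2%:R]natr1 opprD.
    by rewrite cexpD mulNr cexpN !cexp_natM logRP// logLP// exprVn mulrC.
(* This factor is ((1/s + x) / (1/s - x))^mu. For mu = m the sign of 1/s - x = - (x - 1/s) is
   absorbed into the polynomial. *)
have [a' [aS' [P2 [n2 H2]]]] : exists a : C, a \in [:: s^-1; - s^-1] /\ exists P n1,
    forall x, x \notin S -> cexp (- mu * logRR l x + mu * logLL l x) =
      P.[x] * (x - a)^-1 ^+ n1.
  case: muE => ->.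
  - exists s^-1; split; first by rewrite !inE eqxx.
    exists ((- ((s^-1)%:P + 'X)) ^+ m), m => x xS.
    rewrite horner_exp hornerN hornerD hornerX hornerC.
    rewrite cexpD mulNr cexpN !cexp_natM logRRP// logLLP//.
    rewrite -[s^-1 - x]opprB -exprVn invrN -!exprMn; congr (_ ^+ m).
    by rewrite mulrC mulNr mulrN.
  - exists (- s^-1); split; first by rewrite !inE eqxx orbT.
    exists (((s^-1)%:P - 'X) ^+ m), m => x xS.
    rewrite horner_exp hornerD hornerN hornerX hornerC !opprK.
    by rewrite cexpD mulNr cexpN !cexp_natM logRRP// logLLP// -exprVn [s^-1 + x]addrC.
have aa' : a != a'.
  by move: aS aS'; rewrite !inE => /orP[]/eqP -> /orP[]/eqP ->;
    rewrite ?s_neqV ?s_neqNV ?eqr_opp ?s_neqV// eqr_oppLR s_neqNV.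
have aS1 : a \in S by move: aS; rewrite !inE => /orP[] ->; rewrite ?orbT.
have aS2 : a' \in S by move: aS'; rewrite !inE => /orP[] ->; rewrite ?orbT.
apply: primitive_ext (primitive_two_poles sing_uniq (P1 * P2) n1 n2 aS1 aS2 aa').
move=> x xS; rewrite ratioE hornerM.
have -> : comb S (fun b => expo2 b - expo1 b) (branch^~ x) =
   ((nu - 1) * logR l x + (- nu - 1) * logL l x) + (- mu * logRR l x + mu * logLL l x).
  by rewrite /comb sum_sing !expo_diff /branch !at_singE; ring.
by rewrite cexpD H1// H2//; ring.
Qed.


(** The left side is the logarithmic derivative of Phi_1 as obtained from the logarithms, the right
    side the coefficient in [L1]. *)
Lemma simple_part_expo1 x : x \notin S -> simple_part S expo1 x =
  beta1 / (x ^+ 2 - eps%:C) + gamma1 / (1 - eps%:C * x ^+ 2).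
Proof.
move=> /nonsing_neq0[n1 n2 n3 n4]; have s0 := se_neq0.
rewrite /simple_part sum_sing /expo1 !at_singE -se_sqr !opprK.
have n5 : x * s - 1 != 0.
  by rewrite (_ : _ - 1 = (x - s^-1) * s) ?mulf_neq0//; field.
have n6 : x * s + 1 != 0.
  by rewrite (_ : _ + 1 = (x + s^-1) * s) ?mulf_neq0//; field.
have -> : x ^+ 2 - s ^+ 2 = (x - s) * (x + s) by ring.
have -> : 1 - s ^+ 2 * x ^+ 2 = - ((x * s - 1) * (x * s + 1)) by ring.
by field; rewrite n1 n2 n5 n6 s0.
Qed.

(** The same for Phi_2 and [L2]; the term -2x comes from the extra exponents -1 at both s and -s. *)
Lemma simple_part_expo2 x : x \notin S -> simple_part S expo2 x =
  (beta2 - 2 * x) / (x ^+ 2 - eps%:C) + gamma2 / (1 - eps%:C * x ^+ 2).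
Proof.
move=> /nonsing_neq0[n1 n2 n3 n4]; have s0 := se_neq0.
rewrite /simple_part sum_sing /expo2 !at_singE -se_sqr !opprK.
have n5 : x * s - 1 != 0.
  by rewrite (_ : _ - 1 = (x - s^-1) * s) ?mulf_neq0//; field.
have n6 : x * s + 1 != 0.
  by rewrite (_ : _ + 1 = (x + s^-1) * s) ?mulf_neq0//; field.
have -> : x ^+ 2 - s ^+ 2 = (x - s) * (x + s) by ring.
have -> : 1 - s ^+ 2 * x ^+ 2 = - ((x * s - 1) * (x * s + 1)) by ring.
by field; rewrite n1 n2 n5 n6 s0.
Qed.

(** * The fundamental matrix near the base point of the loops, and its monodromy *)

Variables (x0 : C) (x0_ns : x0 \notin S) (l_cont : branches_continuous_near l x0).

Lemma branch_ball : exists2 r : R, 0 < r & forall x, `|x - x0| < r%:C ->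
  x \notin S /\ forall b, b \in S -> is_derive x 1 (branch b) (x - b)^-1.
Proof.
move/nearCP : l_cont => [r1 r10 H1].
move/nearCP : (near_notin_poles x0_ns) => [r2 r20 H2].
exists (Num.min r1 r2); first by rewrite lt_min r10.
move=> x; rewrite modulusE ltcR lt_min => /andP[xr1 xr2].
have xS : x \notin S by apply: H2; rewrite modulusE ltcR.
split=> // b bS; apply: (is_derive_log (branch_sign_neq0 b)).
  have [] := H1 x; first by rewrite modulusE ltcR.
  have eR : branch s = logR l by apply/funext => w; rewrite /branch at_singR.
  have eL : branch (- s) = logL l by apply/funext => w; rewrite /branch at_singL.
  have eRR : branch s^-1 = logRR l by apply/funext => w; rewrite /branch at_singRR.
  have eLL : branch (- s^-1) = logLL l by apply/funext => w; rewrite /branch at_singLL.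
  move: b bS => + + c1 c2 c3 c4.
  apply: (@in_singP (fun b => branch b w @[w --> x] --> branch b x)).
  - by rewrite eR; exact: c1.
  - by rewrite eL; exact: c2.
  - by rewrite eRR; exact: c3.
  - by rewrite eLL; exact: c4.
move/nearCP : (near_notin_poles xS) => [r r0 H]; apply/nearCP; exists r => // w wx.
exact: cexp_branch (H w wx).
Qed.

Lemma expo_cexp_eq a : a \in S ->
  cexp (2 * picx * ii * expo2 a) = cexp (2 * picx * ii * expo1 a).
Proof.
move=> aS; rewrite -[expo2 a](subrK (expo1 a)) mulrDr cexpD.
have -> : cexp (2 * picx * ii * (expo2 a - expo1 a)) = 1; last by rewrite mul1r.
have c0 : cexp (2 * picx * ii) = cexp (0 : C) by rewrite cexp_2pii cexp0.
by rewrite mulrC (cexp_int (expo_diff_int aS) c0) mulr0 cexp0.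
Qed.

Variables (p : R -> C) (p1 : p 1 = x0).
Local Notation Phi := (PhiMx beta gamma l p).
Local Notation rat := (ratio beta gamma l).
Local Notation I := (base_integral beta gamma l p).

(** Brings the integral into the form required by [triangular_mx]. Inside the disc, segments from
    [x0] avoid the poles and [Q] plus the logarithms of the given branches is a primitive of the
    ratio, so the segment integral is a difference of its values. *)
Lemma is_derive_base_integral (r : R) :
  (forall x, `|x - x0| < r%:C ->
    x \notin S /\ forall b, b \in S -> is_derive x 1 (branch b) (x - b)^-1) ->
  forall (Q c : C -> C),
  (forall x, x \notin S -> is_derive x 1 Q (rat x - simple_part S c x)) ->
  exists q : C, forall x, `|x - x0| < r%:C ->
    I x = q + Q x + comb S c (branch ^~ x) /\ is_derive x 1 I (rat x).
Proof.
move=> Hr Q c dQ; pose G x := Q x + comb S c (branch ^~ x).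
have dG x : `|x - x0| < r%:C -> is_derive x 1 G (rat x).
  move=> /Hr[xS dbr]; rewrite -(subrK (simple_part S c x) (rat x)).
  exact: is_derive_addC (dQ x xS) (is_derive_linear_comb c dbr).
pose q := path_integral rat p - G x0.
have IE x : `|x - x0| < r%:C -> I x = q + G x.
  move=> xr; rewrite /base_integral p1.
  have sr t : 0 <= t <= 1 -> `|segment x0 x t - x0| < r%:C.
    move=> t01; rewrite /segment addrAC subrr add0r.
    by apply: le_lt_trans xr; rewrite !modulusE lecR; exact: modulus_scale_le.
  rewrite (_ : path_integral rat (segment x0 x) = G x - G x0); first by rewrite addrA addrAC.
  exact: (@path_integral_segment _ rat G x0 x (fun t t01 => dG _ (sr t t01))
    (fun t t01 => ratio_continuous (Hr _ (sr t t01)).1)).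
exists q => x xr; split; first by rewrite IE// addrA.
have D : is_derive x 1 (fun w => q + G w) (rat x).
  by rewrite -[rat x]add0r; exact: is_derive_addC (is_derive_cst q x 1) (dG x xr).
apply: near_eq_is_derive D.
apply/nearCP; exists (r - modulus (x - x0)).
  by rewrite subr_gt0 -ltcR -modulusE.
move=> w wx; apply/esym/IE; rewrite -(subrK x w) -addrA (le_lt_trans (ler_normD _ _))//.
by move: wx; rewrite !modulusE -rmorphD !ltcR; lra.
Qed.

(** [L1] annihilates Phi_1 and sends Phi_1 times the integral to Phi_1 times the ratio, that is
    Phi_2, which [L2] annihilates. The second row is thus indeed the image of the first under
    [L1]. *)
Lemma fundamental_matrix_PhiMx : fundamental_matrix_near eps beta gamma x0 Phi.
Proof.
have [r r0 Hr] := branch_ball.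
have [Q [c dQ]] := ratio_primitive.
have [q Hq] := is_derive_base_integral Hr dQ.
have d1 x : `|x - x0| < r%:C -> is_derive x 1 (Phi1 beta gamma l)
    (Phi1 beta gamma l x * simple_part S expo1 x).
  move=> /Hr[xS dbr].
  have -> : Phi1 beta gamma l = fun w => cexp (comb S expo1 (branch ^~ w)).
    by apply/funext => w; exact: Phi1E.
  exact: is_derive_cexp_comp (is_derive_linear_comb expo1 dbr).
have d2 x : `|x - x0| < r%:C -> is_derive x 1 (Phi2 beta gamma l)
    (Phi2 beta gamma l x * simple_part S expo2 x).
  move=> /Hr[xS dbr].
  have -> : Phi2 beta gamma l = fun w => cexp (comb S expo2 (branch ^~ w)).
    by apply/funext => w; exact: Phi2E.
  exact: is_derive_cexp_comp (is_derive_linear_comb expo2 dbr).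
have d12 x : `|x - x0| < r%:C -> is_derive x 1 (fun w => Phi1 beta gamma l w * I w)
    (Phi1 beta gamma l x * simple_part S expo1 x * I x + Phi2 beta gamma l x).
  move=> xr; have <- : Phi1 beta gamma l x * rat x = Phi2 beta gamma l x.
    by rewrite /ratio mulrC divfK// Phi1E cexp_neq0.
  exact: is_derive_mulC (d1 x xr) (Hq x xr).2.
(* [f] is the first row and [g] its image under [L1]. *)
pose f (i : 'I_2) : C -> C := if i == 0 then Phi1 beta gamma l
  else (fun w => Phi1 beta gamma l w * I w).
pose g (i : 'I_2) : C -> C := if i == 0 then fun=> 0 else Phi2 beta gamma l.
have Phi0 i : (fun z => Phi z 0 i) = f i.
  by apply/funext => z; rewrite /PhiMx mxE /= /f; case: (i == 0).
have L1f i x : `|x - x0| < r%:C -> L1 eps beta gamma (f i) x = g i x.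
  move=> xr; have [xS _] := Hr x xr; rewrite /L1 -simple_part_expo1// /f /g.
  case: (i == 0).
    by rewrite (@derive_val _ _ _ _ _ _ _ (d1 x xr)); ring.
  by rewrite (@derive_val _ _ _ _ _ _ _ (d12 x xr)); ring.
apply/nearCP; exists r => // x xr; have [xS _] := Hr x xr.
have near_ball : \forall w \near x, `|w - x0| < r%:C.
  apply/nearCP; exists (r - modulus (x - x0)).
    by rewrite subr_gt0 -ltcR -modulusE.
  move=> w wx; rewrite -(subrK x w) -addrA (le_lt_trans (ler_normD _ _))//.
  by move: wx; rewrite !modulusE -rmorphD !ltcR; lra.
split.
- apply: derivable_mx2.
  + by have [] := d1 x xr.
  + by have [] := d12 x xr.
  + exact: derivable_cst.
  + by have [] := d2 x xr.
- move=> i; rewrite Phi0 /L2 -simple_part_expo2// L1f//.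
  have dg : is_derive x 1 (g i) (g i x * simple_part S expo2 x).
    rewrite /g; case: (i == 0); last exact: d2.
    by rewrite mul0r; exact: is_derive_cst.
  (* Differentiating [L1 (f i)] requires its equality with [g i] on a neighbourhood of [x]. *)
  have D : is_derive x 1 (L1 eps beta gamma (f i)) (g i x * simple_part S expo2 x).
    apply: near_eq_is_derive dg.
    move/nearCP : near_ball => [d d0 H]; apply/nearCP; exists d => // w wx.
    by apply/esym/L1f/H.
  by rewrite (@derive_val _ _ _ _ _ _ _ D); ring.
- move=> i; rewrite Phi0 L1f// /PhiMx mxE /= /g.
  by case: (i == 0).
- by apply: mx2_unit; rewrite ?Phi1E ?Phi2E cexp_neq0.
Qed.

(** With d the residue, the upper right entry Phi_1 I becomes m Phi_1 (I + 2 pi i d), which is Phi_1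
    times m 2 pi i d plus Phi_1 I times m: the second column of the product. *)
Lemma monodromy_PhiMx a : a \in S ->
  let m := cexp (2 * picx * ii * expo1 a) in
  monodromy_matrix eps beta gamma a x0 Phi (mx2 m (m * (2 * picx * ii * Res rat a)) 0 m).
Proof.
move=> aS m; split; first exact: fundamental_matrix_PhiMx.
  by apply: mx2_unit; exact: cexp_neq0.
move=> loop [cl [l0 l1] _ lS [wa wb]].
have [r r0 Hr] := branch_ball.
have [Q [c dQ]] := ratio_primitive.
have [q Hq] := is_derive_base_integral Hr dQ.
have PhiE x : `|x - x0| < r%:C ->
    Phi x = triangular_mx S expo1 expo2 c (branch ^~ x) (q + Q x).
  by move=> xr; rewrite /PhiMx /triangular_mx -Phi1E -Phi2E (Hq x xr).1.
have w b : b \in S -> winding loop b (if b == a then 1 else 0).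
  by move=> bS; case: eqP => [->//|/eqP ba]; exact: wb.
have dQ' x : x \notin S -> derivable Q x 1 by move=> /dQ[].
have x0r : `|x0 - x0| < r%:C by rewrite subrr normr0 ltcR.
have brc b : b \in S -> branch b w @[w --> x0] --> branch b x0.
  by move=> bS; exact: is_derive_cvg ((Hr x0 x0r).2 b bS).
have [F [F1 F2 F3]] := @continues_along_path R S expo1 expo2 c Q dQ' branch branch_sign
  x0 q branch_sign_neq0 cexp_branch brc loop _ cl l0 l1 lS w.
exists F; split; first exact: F1.
  rewrite l0 in F2 *; move/nearCP : F2 => [d d0 H]; apply/nearCP.
  exists (Num.min d r); first by rewrite lt_min d0.
  move=> x; rewrite modulusE ltcR lt_min => /andP[xd xr].
  by rewrite PhiE ?H// modulusE ltcR.
rewrite l1 in F3 *; move/nearCP : F3 => [d d0 H]; apply/nearCP.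
exists (Num.min d r); first by rewrite lt_min d0.
move=> x; rewrite modulusE ltcR lt_min => /andP[xd xr].
rewrite PhiE ?H ?modulusE ?ltcR// /triangular_mx mx2_mul.
(* Applied with [expo1] and [expo2] this gives the multipliers of Phi_1 and Phi_2, and with [c] the
   increment of the integral. *)
have cE (f : C -> C) : comb S f (fun b => branch b x + 2 * picx * ii *
    (if b == a then 1 else 0 : int)%:~R) = comb S f (branch ^~ x) + 2 * picx * ii * f a.
  rewrite /comb; under eq_bigr do rewrite mulrDr.
  rewrite big_split /=; congr (_ + _).
  rewrite (bigD1_seq a) ?sing_uniq//= eqxx mulr1 big1 ?addr0; first by rewrite mulrC.
  by move=> b /negPf ->; rewrite !mulr0.
rewrite (Res_pole sing_uniq aS dQ ratio_continuous) !cE !cexpD expo_cexp_eq// -/m.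
by congr mx2; ring.
Qed.

(** The hypotheses make the diagonal exponential the scalar matrix m, hence central, although its
    argument need not be scalar. *)
Lemma exp_unipotent_comm (m e1 e2 d : C) : cexp e1 = m -> cexp e2 = m ->
  let E := mexp (mx2 e1 0 0 e2) in let U := mexp (mx2 0 d 0 0) in
  E *m U = mx2 m (m * d) 0 m /\ E *m U = U *m E.
Proof.
move=> H1 H2; rewrite /= mexp_diag mexp_nilpotent H1 H2 !mx2_mul.
by split; congr mx2; ring.
Qed.

Lemma monodromy_at a (A T : 'M[C]_2) : a \in S ->
  A = mx2 (2 * picx * ii * expo1 a) 0 0 (2 * picx * ii * expo2 a) ->
  T = mx2 0 (Res rat a) 0 0 ->
  let E := mexp A in let U := mexp ((2 * picx * ii) *: T) in
  monodromy_matrix eps beta gamma a x0 Phi (E *m U) /\ E *m U = U *m E.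
Proof.
move=> aS -> -> E U.
have [EU UE] := exp_unipotent_comm (2 * picx * ii * Res rat a) erefl (expo_cexp_eq aS).
split; last by rewrite /E /U mx2_scale !mulr0.
by rewrite /E /U mx2_scale !mulr0 EU; exact: monodromy_PhiMx.
Qed.

End Resonance.

Theorem theorem4p6 (R : realType) (eps : R) (eps_gt0 : 0 < eps) (eps_lt1 : eps < 1)
    (beta gamma : 'rV[Cx R]_2) (beta_neq : beta 0 0 <> beta 0 1)
    (c : resonance_case) (res : double_resonance eps beta gamma c)
    (l : log_branches eps)
    (x0 : Cx R) (x0_ns : x0 \notin sing eps) (l_cont : branches_continuous_near l x0)
    (j : side) :
  (forall p : R -> Cx R, base_path eps (base0 eps c) x0 p ->
    let E := mexp ((picx * ii) *: (Lambda R + (xj eps j)^-1 *: Bmx beta)) in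
    let U := mexp ((2 * picx * ii) *: Tj beta gamma l j) in
    monodromy_matrix eps beta gamma (xj eps j) x0 (PhiMx beta gamma l p) (E *m U)
    /\ E *m U = U *m E)
  /\
  (forall p : R -> Cx R, base_path eps (baseoo eps c) x0 p ->
    let E := mexp (- (picx * ii * xjj eps j) *: Gmx gamma) in
    let U := mexp ((2 * picx * ii) *: Tjj beta gamma l j) in
    monodromy_matrix eps beta gamma (xjj eps j) x0 (PhiMx beta gamma l p) (E *m U)
    /\ E *m U = U *m E).
Proof.
have s0 := se_neq0 eps_gt0.
have inS (b : Cx R) : b \in [:: se eps; - se eps; (se eps)^-1; - (se eps)^-1] ->
  b \in sing eps by [].
have [eB eG] : Bmx beta = mx2 (beta 0 0) 0 0 (beta 0 1) /\
    Gmx gamma = mx2 (gamma 0 0) 0 0 (gamma 0 1).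
  by split; apply/matrixP => i k; rewrite !mxE;
    case: i => [[|[|//]] ?]; case: k => [[|[|//]] ?] /=;
    rewrite ?mulr1n ?mulr0n //; congr (_ _ _); apply: val_inj.
split=> p [_ _ p1 _].
  apply: (monodromy_at eps_gt0 eps_lt1 beta_neq res x0_ns l_cont p1) => //.
    by apply: inS; case: j; rewrite !inE eqxx ?orbT.
  (* Here pi i (Lambda + B / x_j) is 2 pi i times the diagonal of exponents at x_j: the entry -2 of
     [Lambda] accounts for the exponent shift -1 in Phi_2. *)
  rewrite eB /Lambda !mx2_scale mx2_add mx2_scale !mulr0 !addr0 !mulr0 /expo1 /expo2.
  by case: j; rewrite /xj ?(at_singE eps_gt0 eps_lt1); congr mx2; field.
apply: (monodromy_at eps_gt0 eps_lt1 beta_neq res x0_ns l_cont p1) => //.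
  by apply: inS; case: j; rewrite !inE eqxx ?orbT.
(* At 1/s the exponent is - gamma_k / (2s), at -1/s it is the opposite; multiplied by 2 pi i both
   read - pi i x_jj gamma_k. *)
rewrite eG mx2_scale !mulr0 /expo1 /expo2.
by case: j; rewrite /xjj ?(at_singE eps_gt0 eps_lt1); congr mx2; field.
Qed.
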